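(* Let $K$ be a group, let $(PQR): P\xrightarrow{\bar\jmath}Q\xrightarrow{\bar\phi}R$ be a group extension, and let $\theta:Q\to\mathrm{Out}(K)$ be an outer action. Let $(G,i,\pi)$ and $(G',i',\pi')$ be extensions of $K$ by $Q$ with the same outer action $\theta$ and with isomorphic $P$-subextensions $(KNP)=(N,i_0,\pi_0)$ and $(N',i_0',\pi_0')$, with canonical inclusions $j:N\hookrightarrow G$ and $j':N'\hookrightarrow G'$. Let $\Theta:Q\to\mathrm{Out}(N;K)$ and $\Theta':Q\to\mathrm{Out}(N';K)$ be the mod-$K$ outer actions of the iterated extensions $(G,j,\pi)$ and $(G',j',\pi')$, let $\varphi:N'\to N$ be an isomorphism between the $P$-subextensions $(N',i_0',\pi_0')$ and $(N,i_0,\pi_0)$, and let ${}^\varphi\Theta'(q):=\varphi\circ\Theta'(q)\circ\varphi^{-1}$ in $\mathrm{Out}(N;K)$. Let $\Theta_P$ be the mod-$K$ outer action of $(KNP)$, let $\Gamma\in Z^1(R,H^1(P,Z(K)))$ be the unique 1-cocycle such that ${}^\varphi\Theta'=\Gamma\diamond\Theta$ as $(\theta,\complement_P^Q)$-prolongations of $\Theta_P$, and let $$[e]:=\frac{(G',i',\pi')}{(G,i,\pi)}\in H^2_P(Q,Z(K)).$$ Then $$\mathrm{rd}[e]=[\Gamma]\qquad\text{in }H^1(R,H^1(P,Z(K))).$$ In other words, via the bijection $-\boxtimes G$ from $H^2_P(Q,Z(K))$ to isomorphism classes of extensions of $K$ by $Q$ with outer action $\theta$ and $P$-subextension isomorphic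 to $(N,i_0,\pi_0)$, and the bijection $-\diamond\Theta$ from $H^1(R,H^1(P,Z(K)))$ to $\mathrm{Aut}(KNP)$-conjugacy classes of $(\theta,\complement_P^Q)$-prolongations of $\Theta_P$, the map $\mathrm{rd}$ corresponds to the map sending $(G',i',\pi')$ to the $\mathrm{Aut}(KNP)$-conjugacy class of ${}^\varphi\Theta'$ (which is independent of the choice of $\varphi$).
   Context: Conventions. For a group $H$ and an $H$-module $A$ (multiplicative), cochains are normalized (trivial value whenever an argument is the identity): $Z^1(H,A)$ = maps with $\lambda(h_1h_2)=\lambda(h_1)\cdot{}^{h_1}\lambda(h_2)$; $B^1(H,A)=\{h\mapsto a^{-1}\cdot{}^ha\}$; $Z^2(H,A)$ = normalized maps $d$ with $d(h_1,h_2)d(h_1h_2,h_3)={}^{h_1}d(h_2,h_3)d(h_1,h_2h_3)$; $B^2(H,A)$ = maps $z(h_1)\cdot{}^{h_1}z(h_2)\cdot z(h_1h_2)^{-1}$; $H^n=Z^n/B^n$. Extensions. An extension of $K$ by $Q$ is $(G,i,\pi)$ with $i:K\to G$ injective, $\pi:G\to Q$ surjective homomorphisms, $i(K)=\mathrm{Ker}(\pi)$; groups are identified with their images under the given injections. An isomorphism of extensions is a group isomorphism $\varphi:G_1\to G_2$ with $\varphi\circ i_1=i_2$, $\pi_2\circ\varphi=\pi_1$. Conjugation induces the outer action $Q\to\mathrm{Out}(K)=\mathrm{Aut}(K)/\mathrm{Inn}(K)$. The $P$-subextension of $(G,i,\pi)$ is the extension $(N,i_0,\pi_0)$ of $K$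 by $P$ with $N:=\pi^{-1}(P)$ and induced maps; with $j:N\to G$ the inclusion, $(G,j,\pi)$ is then an iterated extension of $(KNP)$ by $(PQR)$ (i.e. $\pi\circ j=\bar\jmath\circ\pi_0$, $j(N)=\mathrm{Ker}(\bar\phi\circ\pi)$, $(j\circ i_0)(K)=\mathrm{Ker}(\pi)$). $Q$ acts on $Z(K)$ via $\theta$. $R$ acts on $H^1(P,Z(K))$ by ${}^r[\lambda]=[{}^q\lambda]$ for any $q$ with $\bar\phi(q)=r$, where ${}^q\lambda(p)={}^{\theta(q)}\lambda(q^{-1}pq)$. Mod-$K$ outer actions. $\mathrm{Aut}_K(N)$ is the group of automorphisms of $N$ mapping $K$ onto $K$; $\mathrm{Out}(N;K):=\mathrm{Aut}_K(N)/\complement_N(K)$, with $\complement_N(K)$ the inner automorphisms by elements of $K$. $\Theta_P:P\to\mathrm{Out}(N;K)$ is induced by conjugation of $N$ on itself. The mod-$K$ outer action of $(G,j,\pi)$ sends $\pi(g)\in Q$ to the class in $\mathrm{Out}(N;K)$ of conjugation by $g\in G$ on $N$. A $(\theta,\complement_P^Q)$-prolongation of $\Theta_P$ is a homomorphism $\Theta:Q\to\mathrm{Out}(N;K)$ with $\Theta\circ\bar\jmath=\Theta_P$ inducing $\theta:Q\to\mathrm{Out}(K)$ and the conjugation action $\complement_P^Q:Q\to\mathrm{Aut}(P)$. $\mathrm{Aut}(KNP):=\{\eta\in\mathrm{Aut}(N):\eta\circ i_0=i_0,\pi_0\circ\eta=\pi_0\}$, and $\mathrm{Out}(KNP;K)$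 is its image in $\mathrm{Out}(N;K)$; $H^1(P,Z(K))$ is identified with $\mathrm{Out}(KNP;K)$ by sending $[\lambda]$ to the class of $n\mapsto\lambda(\pi_0(n))\cdot n$. For $\Gamma\in Z^1(R,H^1(P,Z(K)))$, $\Gamma\diamond\Theta$ is the map $q\mapsto\Gamma(\bar\phi(q))\cdot\Theta(q)$; $\Gamma\mapsto\Gamma\diamond\Theta$ is a bijection from $Z^1(R,H^1(P,Z(K)))$ onto the set of $(\theta,\complement_P^Q)$-prolongations of $\Theta_P$, inducing a bijection from $H^1(R,H^1(P,Z(K)))$ onto their $\mathrm{Aut}(KNP)$-conjugacy classes, where $\Theta_1,\Theta_2$ are $\mathrm{Aut}(KNP)$-conjugate iff $\Theta_2(q)=\bar\eta^{-1}\Theta_1(q)\bar\eta$ for all $q$, for some $\bar\eta\in\mathrm{Out}(KNP;K)$. Classes. For $e\in Z^2(Q,Z(K))$, $e\boxtimes G$ is the set $G$ with multiplication $(g_1,g_2)\mapsto e(\pi(g_1),\pi(g_2))\cdot g_1\cdot g_2$; $[e]\mapsto(e\boxtimes G,i,\pi)$ is a bijection from $H^2(Q,Z(K))$ to isomorphism classes of extensions of $K$ by $Q$ with outer action $\theta$, and $\frac{(G',i',\pi')}{(G,i,\pi)}$ denotes the unique $[e]$ with $(G',i',\pi')\cong(e\boxtimes G,i,\pi)$. $H^2_P(Q,Z(K)):=\mathrm{Ker}(\mathrm{res}:H^2(Q,Z(K))\to H^2(P,Z(K)))$ corresponds to the classes with $P$-subextension isomorphic to $(N,i_0,\pi_0)$.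 Reduction. Given $[e]\in H^2_P(Q,Z(K))$, choose a representing 2-cocycle $e$ with $e(\bar\jmath(p_1),\bar\jmath(p_2))=1$ for all $p_1,p_2\in P$. For $r\in R$ and $q\in Q$ with $\bar\phi(q)=r$, the map $p\mapsto e(q,q^{-1}\bar\jmath(p)q)\cdot e(\bar\jmath(p),q)^{-1}$ is a 1-cocycle $P\to Z(K)$ whose class $\Gamma_e(r)\in H^1(P,Z(K))$ is independent of $q$; $\Gamma_e\in Z^1(R,H^1(P,Z(K)))$, and $\mathrm{rd}[e]:=[\Gamma_e]\in H^1(R,H^1(P,Z(K)))$, independent of the choice of such $e$. *)

(* Defs.v *)
From HB Require Import structures.
From mathcomp Require Import all_boot.
From mathcomp Require Import boolp classical_sets.

Set Implicit Arguments.
Unset Strict Implicit.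
Unset Printing Implicit Defensive.

(* Groups are [groupType]s, possibly infinite.  The choice structure such a
   type carries is no restriction on the group, since classical choice is
   assumed throughout ([boolp]).
   Actions are on the left: the conjugate of [n] by [g] is [g * n * g^-1],
   which MathComp would write [n ^ g^-1]. *)

Local Open Scope group_scope.
Local Open Scope quotient_scope.

Notation "{ 'hom' G -> H }" := (UMagmaMorphism.type G%type H%type)
  (at level 0, G at level 98, H at level 99, format "{ 'hom'  G  ->  H }")
  : type_scope.

Record subgroup (G : groupType) := Subgroup {
  sg_mem :> G -> Prop;
  sg1 : sg_mem 1;
  sgF : forall x y, sg_mem x -> sg_mem y -> sg_mem (x / y)
}.

Section SubgroupType.
Variables (G : groupType) (H : subgroup G).

Record sg_type := SgType { sg_val : G; _ : `[< H sg_val >] }.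

HB.instance Definition _ := [isSub for sg_val].
HB.instance Definition _ := [Choice of sg_type by <:].

Let sg_closed : group_closed [pred x : G | `[< H x >]].
Proof.
split=> [|x y /asboolP Hx /asboolP Hy]; apply/asboolP; first exact: sg1.
exact: sgF.
Qed.

HB.instance Definition _ :=
  SubChoice_isSubGroup.Build G (fun x => `[< H x >]) sg_type sg_closed.

Definition sg_group : groupType := sg_type.

Definition mksg (x : G) (Hx : H x) : sg_group := Sub x (asboolT Hx).

Lemma mksgK x Hx : \val (@mksg x Hx) = x. Proof. exact: SubK. Qed.

Lemma sgP (x : sg_group) : H (\val x).
Proof. by case: x => x /= /asboolP. Qed.

Lemma sg_inj (x y : sg_group) : \val x = \val y -> x = y.
Proof. exact: val_inj. Qed.

Lemma sgvM (x y : sg_group) : \val (x * y) = \val x * \val y.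
Proof. by []. Qed.
Lemma sgv1 : \val (1 : sg_group) = 1.
Proof. by []. Qed.
Lemma sgvV (x : sg_group) : \val (x^-1) = (\val x)^-1.
Proof. by []. Qed.

End SubgroupType.

Coercion sg_group : subgroup >-> Group.type.

Record nsubgroup (G : groupType) := NSubgroup {
  nsg_sub :> subgroup G;
  nsgJ : forall x g, nsg_sub x -> nsg_sub (g * x * g^-1)
}.

Section Quotient.
Variables (G : groupType) (H : nsubgroup G).

Definition cosetr : rel G := fun x y => `[< H (x^-1 * y) >].

Let cosetr_refl : reflexive cosetr.
Proof. by move=> x; apply/asboolP; rewrite mulVg; exact: sg1. Qed.

Let sgV_ x : H x -> H x^-1.
Proof. by move=> Hx; rewrite -[x^-1]mul1g; apply: sgF => //; exact: sg1. Qed.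

Let sgM_ x y : H x -> H y -> H (x * y).
Proof. by move=> Hx Hy; rewrite -[y]invgK; apply: sgF => //; exact: sgV_. Qed.

Let cosetr_sym : symmetric cosetr.
Proof.
by move=> x y; apply/asboolP/asboolP => /sgV_; rewrite invgM invgK.
Qed.

Let cosetr_trans : transitive cosetr.
Proof.
move=> y x z /asboolP Hxy /asboolP Hyz; apply/asboolP.
by have := sgM_ Hxy Hyz; rewrite -mulgA mulVKg.
Qed.

Definition coset_equiv := EquivRel cosetr cosetr_refl cosetr_sym cosetr_trans.
Canonical coset_equiv.

Definition quot_type := {eq_quot coset_equiv}.

HB.instance Definition _ := Choice.on quot_type.
HB.instance Definition _ := EqQuotient.on quot_type.

Definition cls_ (x : G) : quot_type := \pi x.

Let clsP x y : cls_ x = cls_ y <-> H (x^-1 * y).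
Proof.
split=> [/eqmodP/asboolP //|Hxy]; apply/eqmodP; exact/asboolP.
Qed.

Let quot_mul (u v : quot_type) : quot_type := cls_ (repr u * repr v).
Let quot_inv (u : quot_type) : quot_type := cls_ (repr u)^-1.

Let cls_ind (P : quot_type -> Prop) : (forall x, P (cls_ x)) -> forall u, P u.
Proof. by move=> Px u; rewrite -[u]reprK; exact: Px. Qed.

Let Hrepr x : H (x^-1 * repr (cls_ x)).
Proof. by apply/clsP; rewrite /cls_ reprK. Qed.

Let cls_M x y : cls_ (x * y) = quot_mul (cls_ x) (cls_ y).
Proof.
apply/clsP; set x' := repr _; set y' := repr _.
have -> : (x * y)^-1 * (x' * y') = (y^-1 * (x^-1 * x') * y^-1^-1) * (y^-1 * y').
  by rewrite invgM invgK !mulgA mulgK.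
by apply: sgM_; [apply: nsgJ|]; exact: Hrepr.
Qed.

Let cls_V x : cls_ (x^-1) = quot_inv (cls_ x).
Proof.
apply/clsP; set x' := repr _; rewrite invgK.
have -> : x * x'^-1 = x * (x^-1 * x')^-1 * x^-1 by rewrite invgM invgK mulgA mulgK.
by apply/nsgJ/sgV_/Hrepr.
Qed.

Let quot_mulA : associative quot_mul.
Proof.
by elim/cls_ind => x; elim/cls_ind => y; elim/cls_ind => z; rewrite -!cls_M mulgA.
Qed.
Let quot_mul1 : left_id (cls_ 1) quot_mul.
Proof. by elim/cls_ind => x; rewrite -!cls_M mul1g. Qed.
Let quot_mulr1 : right_id (cls_ 1) quot_mul.
Proof. by elim/cls_ind => x; rewrite -!cls_M mulg1. Qed.
Let quot_mulV : left_inverse (cls_ 1) quot_inv quot_mul.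
Proof. by elim/cls_ind => x; rewrite -cls_V -!cls_M mulVg. Qed.
Let quot_mulrV : right_inverse (cls_ 1) quot_inv quot_mul.
Proof. by elim/cls_ind => x; rewrite -cls_V -!cls_M mulgV. Qed.

HB.instance Definition _ := isGroup.Build quot_type
  quot_mulA quot_mul1 quot_mulr1 quot_mulV quot_mulrV.

Definition quot_group : groupType := quot_type.

Definition cls (x : G) : quot_group := cls_ x.
Definition rep (u : quot_group) : G := repr (u : quot_type).

Lemma repK u : cls (rep u) = u. Proof. exact: reprK. Qed.
Lemma cls_eq x y : cls x = cls y <-> H (x^-1 * y). Proof. exact: clsP. Qed.
Lemma clsM x y : cls (x * y) = cls x * cls y. Proof. exact: cls_M. Qed.
Lemma cls1 : cls 1 = 1. Proof. by []. Qed.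
Lemma clsV x : cls x^-1 = (cls x)^-1. Proof. exact: cls_V. Qed.
Lemma quot_ind (P : quot_group -> Prop) : (forall x, P (cls x)) -> forall u, P u.
Proof. exact: cls_ind. Qed.

End Quotient.

Definition map_to (T : Type) (A : Type) := T -> A.

Section FunGroup.
Variables (T : Type) (A : groupType).
Notation F := (map_to T A).
HB.instance Definition _ := gen_eqMixin F.
HB.instance Definition _ := gen_choiceMixin F.

Let fmul (f g : F) : F := fun t => f t * g t.
Let fone : F := fun=> 1.
Let finv (f : F) : F := fun t => (f t)^-1.
Let fmulA : associative fmul.
Proof. by move=> f g h; apply/funext => t; exact: mulgA. Qed.
Let fmul1 : left_id fone fmul.
Proof. by move=> f; apply/funext => t; exact: mul1g. Qed.
Let fmulr1 : right_id fone fmul.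
Proof. by move=> f; apply/funext => t; exact: mulg1. Qed.
Let fmulV : left_inverse fone finv fmul.
Proof. by move=> f; apply/funext => t; exact: mulVg. Qed.
Let fmulrV : right_inverse fone finv fmul.
Proof. by move=> f; apply/funext => t; exact: mulgV. Qed.

HB.instance Definition _ := isGroup.Build F fmulA fmul1 fmulr1 fmulV fmulrV.
End FunGroup.

Record giso (G H : groupType) := GIso {
  giso_fun :> G -> H;
  giso_inv : H -> G;
  gisoM : {morph giso_fun : x y / x * y};
  gisoK : cancel giso_fun giso_inv;
  gisoVK : cancel giso_inv giso_fun
}.

Section GIsoTheory.
Variables (G H : groupType).
Implicit Types f g : giso G H.

Lemma giso_eq f g : f =1 g -> f = g.
Proof.
case: f g => [f f' fM fK f'K] [g g' gM gK g'K] /= /funext fg; subst g.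
have fg' : f' = g' by apply/funext => x; rewrite -[x]g'K fK gK.
by subst g'; congr GIso.
Qed.

Lemma giso1 f : f 1 = 1.
Proof. by have := gisoM f 1 1; rewrite !mulg1 -{1}[f 1]mulg1 => /mulgI <-. Qed.

Lemma gisoV f x : f x^-1 = (f x)^-1.
Proof. by apply/esym/mulg1_eq; rewrite -gisoM mulgV giso1. Qed.

End GIsoTheory.

Definition giso_id (G : groupType) : giso G G :=
  @GIso G G id id (fun _ _ => erefl) (fun _ => erefl) (fun _ => erefl).

Definition giso_comp (G H L : groupType) (g : giso H L) (f : giso G H) :
  giso G L.
Proof.
exists (g \o f) (giso_inv f \o giso_inv g).
- by move=> x y /=; rewrite !gisoM.
- by move=> x /=; rewrite !gisoK.
- by move=> x /=; rewrite !gisoVK.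
Defined.

Lemma giso_symM (G H : groupType) (f : giso G H) :
  {morph giso_inv f : x y / x * y}.
Proof. by move=> x y; apply: (canLR (gisoK f)); rewrite gisoM !gisoVK. Qed.

Definition giso_sym (G H : groupType) (f : giso G H) : giso H G :=
  @GIso H G (giso_inv f) f (giso_symM f) (gisoVK f) (gisoK f).

Section AutGroup.
Variable G : groupType.

Definition aut := giso G G.
HB.instance Definition _ := gen_eqMixin aut.
HB.instance Definition _ := gen_choiceMixin aut.

Let mulA : associative (@giso_comp G G G).
Proof. by move=> f g h; apply: giso_eq. Qed.
Let mul1 : left_id (giso_id G) (@giso_comp G G G).
Proof. by move=> f; apply: giso_eq. Qed.
Let mulr1 : right_id (giso_id G) (@giso_comp G G G).
Proof. by move=> f; apply: giso_eq. Qed.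
Let mulV : left_inverse (giso_id G) (@giso_sym G G) (@giso_comp G G G).
Proof. by move=> f; apply: giso_eq => x /=; rewrite gisoK. Qed.
Let mulrV : right_inverse (giso_id G) (@giso_sym G G) (@giso_comp G G G).
Proof. by move=> f; apply: giso_eq => x /=; rewrite gisoVK. Qed.

HB.instance Definition _ := isGroup.Build aut mulA mul1 mulr1 mulV mulrV.

(* The product [f * g] is the composite [f \o g]. *)
Definition autg : groupType := aut.

Lemma autM (f g : autg) x : (f * g) x = f (g x). Proof. by []. Qed.
Lemma aut1 x : (1 : autg) x = x. Proof. by []. Qed.
Lemma autV (f : autg) x : (f^-1) x = giso_inv f x. Proof. by []. Qed.

End AutGroup.

Section Abel.
Variable A : groupType.
Hypothesis mC : commutative (@mul A).

Let mACA (x y z t : A) : (x * y) * (z * t) = (x * z) * (y * t).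
Proof. by rewrite -!mulgA; congr (_ * _); rewrite !mulgA (mC y). Qed.

Inductive aexp := AX of nat | A1 | AM of aexp & aexp | AV of aexp.

Fixpoint aev (s : seq A) e : A :=
  match e with
  | AX i => nth 1 s i | A1 => 1
  | AM e f => aev s e * aev s f | AV e => (aev s e)^-1
  end.

Fixpoint acnt (b : bool) e i : nat :=
  match e with
  | AX j => b && (i == j) | A1 => 0
  | AM e f => acnt b e i + acnt b f i | AV e => acnt (~~ b) e i
  end.

Fixpoint aprod (f g : nat -> nat) (s : seq A) : A :=
  if s is x :: s' then x ^+ f 0 / x ^+ g 0 * aprod (f \o S) (g \o S) s' else 1.

Lemma aprod_ext f g f' g' s :
  (forall i, i < size s -> f i + g' i = f' i + g i) ->
  aprod f g s = aprod f' g' s.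
Proof.
elim: s f g f' g' => //= x s IH f g f' g' fg; congr (_ * _); last first.
  by apply: IH => i lt_i; apply: (fg i.+1).
apply: (mulIg (x ^+ g 0)); rewrite mulgVK; apply: (mulIg (x ^+ g' 0)).
by rewrite -expgnDr (fg 0)// expgnDr -!mulgA (mC (x ^+ g 0)) mulKg mC.
Qed.

Lemma aprodM f g f' g' s :
  aprod (fun i => f i + f' i) (fun i => g i + g' i) s = aprod f g s * aprod f' g' s.
Proof.
elim: s f g f' g' => [|x s IH] f g f' g' /=; first by rewrite mul1g.
rewrite (IH (f \o S) (g \o S) (f' \o S) (g' \o S)) !expgnDr invgM.
by rewrite (mC (x ^- g' 0)) (mACA (x ^+ f 0)) [LHS]mACA.
Qed.

Lemma aprodV f g s : aprod g f s = (aprod f g s)^-1.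
Proof.
elim: s f g => [|x s IH] f g /=; first by rewrite invg1.
by rewrite (IH (f \o S) (g \o S)) !invgM invgK [LHS]mC.
Qed.

Lemma aprodX j s : aprod (fun i => i == j) (fun=> 0) s = nth 1 s j.
Proof.
elim: s j => [|x s IH] [|j] //=; rewrite ?invg1 ?mulg1 ?mul1g.
  rewrite expg1 (_ : aprod _ _ s = 1) ?mulg1 // /comp /=.
  by elim: s {IH} => //= y s IHs; rewrite invg1 !mul1g.
exact: IH.
Qed.

Lemma aevE s e : aev s e = aprod (acnt true e) (acnt false e) s.
Proof.
elim: e => [j||e IHe f IHf|e IH] /=; rewrite ?IHe ?IHf ?IH ?aprodM ?aprodX //.
  by elim: s => //= x s <-; rewrite invg1 !mul1g.
exact: (esym (aprodV _ _ _)).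
Qed.

Lemma abelP s n e f : size s = n ->
  all (fun i => acnt true e i + acnt false f i == acnt true f i + acnt false e i)
    (iota 0 n) ->
  aev s e = aev s f.
Proof.
move=> <- /allP ef; rewrite !aevE; apply: aprod_ext => i lt_i; apply/eqP/ef.
by rewrite mem_iota.
Qed.

End Abel.

Ltac abel_mem x s :=
  lazymatch s with
  | nil => constr:(false)
  | cons ?y ?s => match constr:(Set) with
                  | _ => let _ := match constr:(Set) with _ => unify x y end in
                         constr:(true)
                  | _ => abel_mem x s
                  end
  end.
Ltac abel_atoms s t :=
  lazymatch t with
  | mul ?x ?y => let s := abel_atoms s x in abel_atoms s y
  | inv ?x => abel_atoms s x
  | one => s
  | _ => lazymatch abel_mem t s with true => s | false => constr:(cons t s) end
  end.
Ltac abel_index x s :=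
  lazymatch s with
  | cons ?y ?s => match constr:(Set) with
                  | _ => let _ := match constr:(Set) with _ => unify x y end in
                         constr:(0%N)
                  | _ => let n := abel_index x s in constr:(S n)
                  end
  end.
Ltac abel_reify s t :=
  lazymatch t with
  | mul ?x ?y => let e := abel_reify s x in let f := abel_reify s y in constr:(AM e f)
  | inv ?x => let e := abel_reify s x in constr:(AV e)
  | one => constr:(A1)
  | _ => let n := abel_index t s in constr:(AX n)
  end.
(* Decides equalities between words of a commutative group; [mC] is the proof
   of commutativity. *)
Ltac abel mC :=
  lazymatch goal with |- @eq ?T ?x ?y =>
    let s := abel_atoms (@nil T) x in
    let s := abel_atoms s y in
    let e := abel_reify s x in
    let f := abel_reify s y in
    exact (@abelP _ mC s _ e f erefl isT)
  end.

Lemma abelian_nsgJ (G : groupType) (mC : commutative (@mul G))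
    (H : subgroup G) x g : H x -> H (g * x * g^-1).
Proof. by rewrite (mC g) mulgK. Qed.

Definition abelian_nsubgroup (G : groupType) (mC : commutative (@mul G))
  (H : subgroup G) : nsubgroup G := NSubgroup (@abelian_nsgJ G mC H).

Record gmodule (H : groupType) := GModule {
  gm_group :> groupType;
  gm_mulC : commutative (@mul gm_group);
  gact : H -> gm_group -> gm_group;
  gactM : forall h, {morph gact h : a b / a * b};
  gact1 : forall a, gact 1 a = a;
  gactA : forall h1 h2 a, gact (h1 * h2) a = gact h1 (gact h2 a)
}.

Notation "h ⊳ a" := (gact h a) (at level 39, right associativity).

Section ModuleTheory.
Variables (H : groupType) (M : gmodule H).
Implicit Types (h : H) (a : M).

Lemma gact_1 h : h ⊳ (1 : M) = 1.
Proof. by apply: (mulgI (h ⊳ (1 : M))); rewrite -gactM !mulg1. Qed.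

Lemma gactV h a : h ⊳ a^-1 = (h ⊳ a)^-1.
Proof. by apply/esym/mulg1_eq; rewrite -gactM mulgV gact_1. Qed.

Lemma gactK h : cancel (gact h : M -> M) (gact h^-1).
Proof. by move=> a; rewrite -gactA mulVg gact1. Qed.

End ModuleTheory.

Section Restriction.
Variables (P Q : groupType) (f : {hom P -> Q}) (M : gmodule Q).

Let res_act (p : P) (a : M) : M := f p ⊳ a.
Let res_act1 a : res_act 1 a = a.
Proof. by rewrite /res_act gmulf1 gact1. Qed.
Let res_actA p1 p2 a : res_act (p1 * p2) a = res_act p1 (res_act p2 a).
Proof. by rewrite /res_act gmulfM gactA. Qed.

Definition gmod_res : gmodule P :=
  GModule (@gm_mulC Q M) (fun p => @gactM Q M (f p)) res_act1 res_actA.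

End Restriction.

Section Cohomology.
Variables (H : groupType) (M : gmodule H).
Let mC := @gm_mulC H M.

(* Such maps are automatically normalized, see [Z1_1]. *)
Definition Z1_mem (l : map_to H M) : Prop :=
  forall h1 h2, l (h1 * h2) = l h1 * (h1 ⊳ l h2).

Lemma Z1_mem1 : Z1_mem 1.
Proof. by move=> h1 h2; rewrite /= gact_1 mulg1. Qed.

Lemma Z1_memF l m : Z1_mem l -> Z1_mem m -> Z1_mem (l / m).
Proof.
move=> Zl Zm h1 h2.
rewrite -[LHS]/(l (h1 * h2) * (m (h1 * h2))^-1).
rewrite -[RHS]/((l h1 * (m h1)^-1) * (h1 ⊳ (l h2 * (m h2)^-1))).
rewrite Zl Zm gactM gactV; abel mC.
Qed.

Definition Z1 : subgroup (map_to H M) := Subgroup Z1_mem1 Z1_memF.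

Lemma Z1_mulC : commutative (@mul Z1).
Proof. by move=> l m; apply/sg_inj/funext => h; apply: mC. Qed.

Lemma Z1E (l : Z1) h1 h2 : \val l (h1 * h2) = \val l h1 * (h1 ⊳ \val l h2).
Proof. exact: (sgP l). Qed.

Lemma Z1_1 (l : Z1) : \val l 1 = 1.
Proof. by apply: (mulgI (\val l 1)); rewrite mulg1 -{2}[\val l 1]gact1 -Z1E mulg1. Qed.

Definition B1_mem (l : Z1) : Prop :=
  exists a : M, forall h, \val l h = a^-1 * (h ⊳ a).

Lemma B1_mem1 : B1_mem 1.
Proof. by exists 1 => h; rewrite gact_1 mulVg. Qed.

Lemma B1_memF l m : B1_mem l -> B1_mem m -> B1_mem (l / m).
Proof.
move=> [a la] [b mb]; exists (a / b) => h.
rewrite -[LHS]/(\val l h * (\val m h)^-1) la mb gactM gactV; abel mC.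
Qed.

Definition B1 : nsubgroup Z1 :=
  abelian_nsubgroup Z1_mulC (Subgroup B1_mem1 B1_memF).
Definition H1 : groupType := quot_group B1.

Lemma H1_mulC : commutative (@mul H1).
Proof.
elim/quot_ind => l; elim/quot_ind => m; rewrite -!clsM; congr cls.
exact: Z1_mulC.
Qed.

Lemma H1_eq (l m : Z1) :
  cls B1 l = cls B1 m <-> exists a : M, forall h, \val m h = \val l h * (a^-1 * (h ⊳ a)).
Proof.
rewrite cls_eq; split=> -[a la]; exists a => h.
  by rewrite -la -[X in _ = _ * X]/((\val l h)^-1 * \val m h) mulVKg.
by rewrite -[LHS]/((\val l h)^-1 * \val m h) la mulKg.
Qed.

Definition Z2_mem (e : map_to H (map_to H M)) : Prop :=
  [/\ forall h, e 1 h = 1, forall h, e h 1 = 1 &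
  forall h1 h2 h3,
    e h1 h2 * e (h1 * h2) h3 = (h1 ⊳ e h2 h3) * e h1 (h2 * h3)].

Lemma Z2_mem1 : Z2_mem 1.
Proof. by split=> // h1 h2 h3; rewrite /= gact_1. Qed.

Lemma Z2_memF d e : Z2_mem d -> Z2_mem e -> Z2_mem (d / e).
Proof.
move=> [d1 dr1 dM] [e1 er1 eM]; split=> [h|h|h1 h2 h3].
- by rewrite -[LHS]/(d 1 h * (e 1 h)^-1) d1 e1 mulgV.
- by rewrite -[LHS]/(d h 1 * (e h 1)^-1) dr1 er1 mulgV.
rewrite -[LHS]/((d h1 h2 * (e h1 h2)^-1) * (d (h1 * h2) h3 * (e (h1 * h2) h3)^-1)).
rewrite -[RHS]/((h1 ⊳ (d h2 h3 * (e h2 h3)^-1)) *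
                (d h1 (h2 * h3) * (e h1 (h2 * h3))^-1)).
rewrite gactM gactV.
transitivity ((d h1 h2 * d (h1 * h2) h3) * (e h1 h2 * e (h1 * h2) h3)^-1).
  by abel mC.
by rewrite dM eM; abel mC.
Qed.

Definition Z2 : subgroup (map_to H (map_to H M)) := Subgroup Z2_mem1 Z2_memF.

Lemma Z2_mulC : commutative (@mul Z2).
Proof. by move=> d e; apply/sg_inj/funext => h; apply/funext => h'; apply: mC. Qed.

Lemma Z2E (e : Z2) h1 h2 h3 :
  \val e h1 h2 * \val e (h1 * h2) h3 = (h1 ⊳ \val e h2 h3) * \val e h1 (h2 * h3).
Proof. by have [_ _] := sgP e; apply. Qed.
Lemma Z2_1g (e : Z2) h : \val e 1 h = 1. Proof. by have [] := sgP e. Qed.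
Lemma Z2_g1 (e : Z2) h : \val e h 1 = 1. Proof. by have [] := sgP e. Qed.

Definition cobd (z : H -> M) (h1 h2 : H) : M :=
  z h1 * (h1 ⊳ z h2) * (z (h1 * h2))^-1.

(* The cochain [z] has to be normalized for its coboundary to be so. *)
Definition B2_mem (e : Z2) : Prop :=
  exists2 z : H -> M, z 1 = 1 & forall h1 h2, \val e h1 h2 = cobd z h1 h2.

Lemma B2_mem1 : B2_mem 1.
Proof. by exists (fun=> 1) => // h1 h2; rewrite /cobd gact_1 mul1g mulgV. Qed.

Lemma B2_memF d e : B2_mem d -> B2_mem e -> B2_mem (d / e).
Proof.
move=> [y y1 dy] [z z1 ez]; exists (fun h => y h / z h) => [|h1 h2].
  by rewrite y1 z1 mulgV.
rewrite -[LHS]/(\val d h1 h2 * (\val e h1 h2)^-1) dy ez /cobd gactM gactV.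
by abel mC.
Qed.

Definition B2 : nsubgroup Z2 :=
  abelian_nsubgroup Z2_mulC (Subgroup B2_mem1 B2_memF).
Definition H2 : groupType := quot_group B2.

Lemma cobd_Z2 (z : H -> M) : z 1 = 1 -> Z2 (cobd z).
Proof.
move=> z1; split=> [h|h|h1 h2 h3]; rewrite /cobd.
- by rewrite mul1g z1 mul1g gact1 mulgV.
- by rewrite mulg1 z1 gact_1 mulg1 mulgV.
by rewrite !gactM !gactV !mulgA -gactA; abel mC.
Qed.

End Cohomology.

Record extension (K Q : groupType) := Extension {
  ext_group :> groupType;
  ext_in : {hom K -> ext_group};
  ext_pr : {hom ext_group -> Q};
  ext_inI : injective ext_in;
  ext_prS : forall q, exists g, ext_pr g = q;
  ext_ker : forall g, ext_pr g = 1 <-> exists k, ext_in k = g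
}.
Arguments ext_in {K Q} e.
Arguments ext_pr {K Q} e.

Section ExtensionTheory.
Variables (K Q : groupType) (E : extension K Q).

(* [ext_ret g] is the [k] with [ext_in E k = g], and [1] if [g] is not in the
   image of [K]; [ext_lift q] is a chosen preimage of [q]. *)
Definition ext_ret (g : E) : K := xget 1 [set k | ext_in E k = g]%classic.
Definition ext_lift (q : Q) : E := xget 1 [set g | ext_pr E g = q]%classic.

Lemma ext_retK : cancel (ext_in E) ext_ret.
Proof.
move=> k; apply: (@ext_inI _ _ E).
exact: (@xgetI _ 1 [set k' | ext_in E k' = ext_in E k]%classic k).
Qed.

Lemma ext_retE g : ext_pr E g = 1 -> ext_in E (ext_ret g) = g.
Proof. by move=> /ext_ker [k <-]; rewrite ext_retK. Qed.

Lemma ext_liftK q : ext_pr E (ext_lift q) = q.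
Proof.
exact: (@xgetPex _ 1 [set g | ext_pr E g = q]%classic (ext_prS E q)).
Qed.

Lemma ext_pr_in k : ext_pr E (ext_in E k) = 1.
Proof. by apply/ext_ker; exists k. Qed.

End ExtensionTheory.

Section Reduction.
Variables (P R : groupType) (Q : extension P R) (M : gmodule Q).
Notation j := (ext_in Q).
Notation phi := (ext_pr Q).
Let mC := @gm_mulC Q M.

(* [p |-> q^-1 p q]; [P] is identified with its image in [Q]. *)
Definition pconj (q : Q) (p : P) : P := ext_ret (q^-1 * j p * q).

Lemma pconjE q p : j (pconj q p) = q^-1 * j p * q.
Proof. by apply: ext_retE; rewrite !gmulfM ext_pr_in mulg1 gmulfV mulVg. Qed.

Lemma pconjM q : {morph pconj q : p1 p2 / p1 * p2}.
Proof.
by move=> p1 p2; apply: (@ext_inI _ _ Q); rewrite gmulfM !pconjE gmulfM !mulgA mulgK.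
Qed.

Lemma pconjA q1 q2 p : pconj (q1 * q2) p = pconj q2 (pconj q1 p).
Proof. by apply: (@ext_inI _ _ Q); rewrite !pconjE invgM !mulgA. Qed.

Lemma pconj1 p : pconj 1 p = p.
Proof. by apply: (@ext_inI _ _ Q); rewrite !pconjE invg1 mulg1 mul1g. Qed.

Lemma pconj_in p0 p : pconj (j p0) p = p0^-1 * p * p0.
Proof. by apply: (@ext_inI _ _ Q); rewrite !pconjE !gmulfM gmulfV. Qed.

Lemma pconjC q p : q * j (pconj q p) = j p * q.
Proof. by rewrite pconjE !mulgA mulgV mul1g. Qed.

Definition gmodP : gmodule P := gmod_res j M.

Lemma Z1_act_mem (q : Q) (l : Z1 gmodP) :
  Z1_mem (fun p => q ⊳ (\val l (pconj q p) : M) : gmodP).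
Proof.
move=> p1 p2; rewrite pconjM (@Z1E _ gmodP) (@gactM _ M); congr (_ * _).
by rewrite -[LHS](@gactA _ M) -[RHS](@gactA _ M) pconjC.
Qed.

Definition Z1_act (q : Q) (l : Z1 gmodP) : Z1 gmodP :=
  @mksg _ (Z1 gmodP) _ (Z1_act_mem q l).

Lemma Z1_actE q l p : \val (Z1_act q l) p = q ⊳ (\val l (pconj q p) : M).
Proof. by []. Qed.

Lemma Z1_actM q : {morph Z1_act q : l m / l * m}.
Proof. by move=> l m; apply/sg_inj/funext => p; apply: (@gactM _ M). Qed.

Lemma Z1_act1 l : Z1_act 1 l = l.
Proof.
by apply/sg_inj/funext => p; rewrite Z1_actE pconj1; apply: (@gact1 _ M).
Qed.

Lemma Z1_actA q1 q2 l : Z1_act (q1 * q2) l = Z1_act q1 (Z1_act q2 l).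
Proof.
by apply/sg_inj/funext => p; rewrite !Z1_actE pconjA; apply: (@gactA _ M).
Qed.

Lemma Z1_act_cls q l m :
  cls (B1 gmodP) l = cls (B1 gmodP) m ->
  cls (B1 gmodP) (Z1_act q l) = cls (B1 gmodP) (Z1_act q m).
Proof.
move=> /H1_eq [a lm]; apply/H1_eq; exists (q ⊳ (a : M)) => p.
rewrite !Z1_actE lm !(@gactM _ M) (@gactV _ M); congr (_ * (_ * _)).
by rewrite -[LHS](@gactA _ M) -[RHS](@gactA _ M) pconjC.
Qed.

Lemma Z1_act_in p0 l : cls (B1 gmodP) (Z1_act (j p0) l) = cls (B1 gmodP) l.
Proof.
apply/esym/H1_eq; exists (\val l p0) => p.
rewrite Z1_actE pconj_in -!mulgA (@Z1E _ gmodP) (@Z1E _ gmodP).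
rewrite -[LHS]/(gact (g := gmodP) p0 _) (@gactM _ gmodP) -(@gactA _ gmodP).
rewrite mulgV gact1 [RHS]mulgA [_ / _](@gm_mulC _ gmodP) -[RHS]mulgA; congr (_ * _).
by apply/esym/mulg1_eq; rewrite -(@Z1E _ gmodP) mulgV Z1_1.
Qed.

Lemma Z1_act_phi q q' l : phi q = phi q' ->
  cls (B1 gmodP) (Z1_act q l) = cls (B1 gmodP) (Z1_act q' l).
Proof.
move=> qq'.
have -> : q = q' * j (ext_ret (q'^-1 * q)).
  by rewrite ext_retE ?mulVKg // gmulfM gmulfV qq' mulVg.
by rewrite Z1_actA; apply/Z1_act_cls/Z1_act_in.
Qed.

(* The choices of lift of [r] and of representative of [u] are immaterial, see
   [H1_actE]. *)
Definition H1_act (r : R) (u : H1 gmodP) : H1 gmodP :=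
  cls _ (Z1_act (ext_lift Q r) (rep u)).

Lemma H1_actE (q : Q) (l : Z1 gmodP) :
  H1_act (phi q) (cls _ l) = cls _ (Z1_act q l).
Proof.
rewrite /H1_act (@Z1_act_phi _ q) ?ext_liftK //.
by apply: Z1_act_cls; rewrite repK.
Qed.

Lemma H1_actM r : {morph H1_act r : u v / u * v}.
Proof.
rewrite -[r](ext_liftK Q); move: (ext_lift Q r) => q.
elim/quot_ind => l; elim/quot_ind => m.
by rewrite -clsM !H1_actE Z1_actM clsM.
Qed.

Lemma H1_act1 u : H1_act 1 u = u.
Proof.
elim/quot_ind: u => l.
by rewrite -[X in H1_act X](@gmulf1 _ _ phi) H1_actE Z1_act1.
Qed.

Lemma H1_actA r1 r2 u : H1_act (r1 * r2) u = H1_act r1 (H1_act r2 u).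
Proof.
rewrite -[r1](ext_liftK Q) -[r2](ext_liftK Q).
move: (ext_lift Q r1) (ext_lift Q r2) => q1 q2; elim/quot_ind: u => l.
by rewrite -gmulfM !H1_actE Z1_actA.
Qed.

Definition H1_mod : gmodule R :=
  GModule (@H1_mulC _ gmodP) H1_actM H1_act1 H1_actA.

Definition res_Z2_fun (e : Z2 M) : map_to P (map_to P gmodP) :=
  fun p1 p2 => \val e (j p1) (j p2).

Lemma res_Z2_mem e : Z2_mem (res_Z2_fun e).
Proof.
split=> [p|p|p1 p2 p3]; rewrite /res_Z2_fun ?gmulf1 ?Z2_1g ?Z2_g1 //.
by rewrite !gmulfM; apply: (Z2E e).
Qed.

Definition res_Z2 (e : Z2 M) : Z2 gmodP := @mksg _ (Z2 gmodP) _ (res_Z2_mem e).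

(* Does not depend on the representative, see [res_H2E]. *)
Definition res_H2 (x : H2 M) : H2 gmodP := cls (B2 gmodP) (res_Z2 (rep x)).

Lemma res_Z2F : {morph res_Z2 : d e / d / e}.
Proof. by move=> d e; apply: sg_inj. Qed.

Lemma res_B2 e : B2_mem e -> B2_mem (res_Z2 e).
Proof.
move=> [z z1 ez]; exists (fun p => z (j p)) => [|p1 p2]; first by rewrite gmulf1.
by rewrite -[LHS]/(\val e (j p1) (j p2)) ez /cobd gmulfM.
Qed.

Lemma res_Z2V : {morph res_Z2 : e / e^-1}.
Proof. by move=> e; apply: sg_inj. Qed.

Lemma res_Z2M : {morph res_Z2 : d e / d * e}.
Proof. by move=> d e; apply: sg_inj. Qed.

Lemma res_H2E e : res_H2 (cls (B2 M) e) = cls (B2 gmodP) (res_Z2 e).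
Proof.
apply/cls_eq; rewrite -res_Z2V -res_Z2M.
by apply: res_B2; apply/(cls_eq (B2 M)); rewrite repK.
Qed.

Definition H2_P_mem (x : H2 M) : Prop := res_H2 x = 1.

Lemma H2_P_mem1 : H2_P_mem 1.
Proof.
by rewrite /H2_P_mem -(cls1 (B2 M)) res_H2E -(cls1 (B2 _)); congr cls; exact: sg_inj.
Qed.

Lemma H2_P_memF x y : H2_P_mem x -> H2_P_mem y -> H2_P_mem (x / y).
Proof.
elim/quot_ind: x => d; elim/quot_ind: y => e.
rewrite /H2_P_mem -clsV -clsM !res_H2E res_Z2M res_Z2V clsM clsV => -> ->.
exact: mulgV.
Qed.

Definition H2_P : subgroup (H2 M) := Subgroup H2_P_mem1 H2_P_memF.

Definition P_trivial (e : Z2 M) : Prop := forall p1 p2, \val e (j p1) (j p2) = 1.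

Lemma H2_P_rep (x : H2_P) : exists e : Z2 M, cls (B2 M) e = \val x /\ P_trivial e.
Proof.
have := sgP x; elim/quot_ind: (\val x) => e {x}.
rewrite -[H2_P _]/(H2_P_mem _) /H2_P_mem res_H2E => /esym/cls_eq [z z1 ez].
pose w (q : Q) : M := if `[< phi q = 1 >] then z (ext_ret q) else 1.
have wj p : w (j p) = z p.
  by rewrite /w; case: asboolP => [_|[]]; rewrite ?ext_retK ?ext_pr_in.
have w1 : w 1 = 1 by rewrite -(@gmulf1 _ _ j) wj z1.
pose dw : Z2 M := @mksg _ (Z2 M) _ (cobd_Z2 w1).
exists (e / dw); split.
  rewrite cls_eq invgM invgK mulgVK; exists w => //.
move=> p1 p2; rewrite -[LHS]/(\val e (j p1) (j p2) * (cobd w (j p1) (j p2))^-1).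
rewrite /cobd -gmulfM !wj.
have := ez p1 p2; rewrite -[X in X = _]/(1^-1 * \val e (j p1) (j p2)).
by rewrite invg1 mul1g => ->; exact: mulgV.
Qed.

Section Gamma.
Variables (e : Z2 M) (eP : P_trivial e).
Notation ev := (\val e : Q -> Q -> M).

Definition Gamma_fun (q : Q) (p : P) : M :=
  ev q (j (pconj q p)) * (ev (j p) q)^-1.

Lemma Gamma_mem q : Z1_mem (Gamma_fun q : map_to P gmodP).
Proof.
move=> p1 p2; rewrite /Gamma_fun -[RHS]/(_ * (j p1 ⊳ (_ : M))) gactM gactV pconjM !gmulfM.
set p1' := j (pconj q p1); set p2' := j (pconj q p2).
have E1 := Z2E e (j p1) (j p2) q; rewrite eP mul1g in E1.
have E2 := Z2E e q p1' p2'; rewrite eP gact_1 mul1g pconjC in E2.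
have E3 := Z2E e (j p1) q p2'; rewrite pconjC in E3.
have E3' : ev (j p1 * q) p2' = (ev (j p1) q)^-1 * ((j p1 ⊳ ev q p2') * ev (j p1) (j p2 * q)).
  by rewrite -E3 mulKg.
by rewrite E1 -E2 E3'; abel mC.
Qed.

Definition Gamma1 (q : Q) : Z1 gmodP := @mksg _ (Z1 gmodP) _ (Gamma_mem q).

Lemma Gamma1_phi q q' : phi q = phi q' ->
  cls (B1 gmodP) (Gamma1 q) = cls (B1 gmodP) (Gamma1 q').
Proof.
move=> qq'; pose p0 := ext_ret (q^-1 * q').
have -> : q' = q * j p0.
  by rewrite ext_retE ?mulVKg // gmulfM gmulfV qq' mulVg.
move: p0 => p0; apply/H1_eq; exists (ev q (j p0)) => p.
rewrite -[LHS]/(Gamma_fun (q * j p0) p) -[\val _ p]/(Gamma_fun q p) /Gamma_fun.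
rewrite -[RHS]/(_ * (_ * (j p ⊳ (_ : M)))) pconjA.
set p' := pconj q p.
have p0p : j p0 * j (pconj (j p0) p') = j p' * j p0 by rewrite pconjC.
have E1 := Z2E e q (j p0) (j (pconj (j p0) p')).
rewrite eP gact_1 mul1g p0p in E1.
have E2 := Z2E e q (j p') (j p0); rewrite eP gact_1 mul1g pconjC -E1 in E2.
have E3 := Z2E e (j p) q (j p0).
have E3' : ev (j p * q) (j p0) =
  (ev (j p) q)^-1 * ((j p ⊳ ev q (j p0)) * ev (j p) (q * j p0)).
  by rewrite -E3 mulKg.
have -> : ev (q * j p0) (j (pconj (j p0) p')) =
  (ev q (j p0))^-1 * (ev q (j p') * ev (j p * q) (j p0)) by rewrite E2 mulKg.
by rewrite E3'; abel mC.
Qed.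

Lemma Gamma1M q1 q2 : cls (B1 gmodP) (Gamma1 (q1 * q2)) =
  cls _ (Gamma1 q1) * cls _ (Z1_act q1 (Gamma1 q2)).
Proof.
rewrite -clsM; apply/esym/H1_eq; exists (ev q1 q2) => p.
rewrite -[LHS]/(Gamma_fun (q1 * q2) p).
transitivity (Gamma_fun q1 p * (q1 ⊳ Gamma_fun q2 (pconj q1 p)) *
              ((ev q1 q2)^-1 * (j p ⊳ ev q1 q2))); last by [].
rewrite /Gamma_fun gactM gactV pconjA.
set p1 := pconj q1 p; set p2 := pconj q2 p1.
have E1 := Z2E e q1 q2 (j p2); rewrite pconjC in E1.
have E2 := Z2E e q1 (j p1) q2; rewrite pconjC in E2.
have E3 := Z2E e (j p) q1 q2.
have -> : ev (q1 * q2) (j p2) =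
  (ev q1 q2)^-1 * ((q1 ⊳ ev q2 (j p2)) * ev q1 (j p1 * q2)).
  by rewrite -E1 mulKg.
have -> : ev q1 (j p1 * q2) =
  (q1 ⊳ ev (j p1) q2)^-1 * (ev q1 (j p1) * ev (j p * q1) q2) by rewrite E2 mulKg.
have -> : ev (j p * q1) q2 =
  (ev (j p) q1)^-1 * ((j p ⊳ ev q1 q2) * ev (j p) (q1 * q2)) by rewrite -E3 mulKg.
by abel mC.
Qed.

Lemma Gamma_Z1 : Z1_mem (fun r => cls (B1 gmodP) (Gamma1 (ext_lift Q r)) : H1_mod).
Proof.
move=> r1 r2 /=; rewrite (@Gamma1_phi _ (ext_lift Q r1 * ext_lift Q r2)).
  rewrite Gamma1M; congr (_ * _).
  by rewrite -H1_actE ext_liftK.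
by rewrite gmulfM !ext_liftK.
Qed.

Definition Gamma_of : Z1 H1_mod := @mksg _ (Z1 H1_mod) _ Gamma_Z1.

Lemma Gamma_ofE q : \val Gamma_of (phi q) = cls (B1 gmodP) (Gamma1 q).
Proof. by apply: Gamma1_phi; rewrite ext_liftK. Qed.

End Gamma.

(* [svalP e] holds a cocycle that represents [x] and is trivial on [P]; the
   choice of it is immaterial, see [rdE]. *)
Definition rd (x : H2_P) : H1 H1_mod :=
  let e := cid (H2_P_rep x) in cls (B1 H1_mod) (Gamma_of (svalP e).2).

Lemma Gamma_of_cls (e e' : Z2 M) (eP : P_trivial e) (eP' : P_trivial e') :
  cls (B2 M) e = cls (B2 M) e' ->
  cls (B1 H1_mod) (Gamma_of eP) = cls (B1 H1_mod) (Gamma_of eP').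
Proof.
move=> /cls_eq [z z1 ez].
have ezE q1 q2 : \val e' q1 q2 = \val e q1 q2 * cobd z q1 q2.
  by rewrite -ez -[X in _ = _ * X]/((\val e q1 q2)^-1 * \val e' q1 q2) mulVKg.
have zP : Z1_mem ((fun p => z (j p)) : map_to P gmodP).
  move=> p1 p2; have := ezE (j p1) (j p2).
  rewrite eP eP' mul1g /cobd -gmulfM => /(congr1 (fun a => a * z (j (p1 * p2)))).
  by rewrite mul1g mulgVK.
pose u : Z1 gmodP := @mksg _ (Z1 gmodP) _ zP.
apply/H1_eq; exists (cls (B1 gmodP) u) => r.
rewrite -[r](ext_liftK Q); move: (ext_lift Q r) => q.
rewrite !Gamma_ofE -[phi q ⊳ _]/(H1_act (phi q) _) H1_actE -clsV.
rewrite -(@clsM _ (B1 gmodP) u^-1) -(@clsM _ (B1 gmodP) (Gamma1 eP q)).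
apply/H1_eq; exists (z q) => p; set p' := j (pconj q p).
transitivity (\val e q p' * (\val e (j p) q)^-1 * ((z (j p))^-1 * (q ⊳ z p'))).
  by [].
transitivity (\val e' q p' * (\val e' (j p) q)^-1 * ((z q)^-1 * (j p ⊳ z q))).
  by rewrite !ezE /cobd pconjC; abel mC.
by [].
Qed.

Lemma rdE (e : Z2 M) (eP : P_trivial e) (x : H2_P) :
  \val x = cls (B2 M) e -> rd x = cls (B1 H1_mod) (Gamma_of eP).
Proof.
by move=> xe; rewrite /rd; case: cid => d [dx dP] /=; apply: Gamma_of_cls; rewrite dx.
Qed.

End Reduction.

Section Outer.
Variable K : groupType.

Definition center_mem (z : K) : Prop := forall k, z * k = k * z.

Lemma center_mem1 : center_mem 1.
Proof. by move=> k; rewrite mul1g mulg1. Qed.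

Lemma center_memF y z : center_mem y -> center_mem z -> center_mem (y / z).
Proof.
move=> Zy Zz k; rewrite mulgA -Zy -!mulgA; congr (_ * _).
by apply: (mulgI z); rewrite mulVKg mulgA Zz mulgK.
Qed.

Definition center : subgroup K := Subgroup center_mem1 center_memF.

Lemma center_mulC : commutative (@mul center).
Proof. by move=> y z; apply/sg_inj/(sgP y). Qed.

Definition Inn_mem (a : autg K) : Prop := exists k, forall x, a x = k * x * k^-1.

Lemma Inn_mem1 : Inn_mem 1.
Proof. by exists 1 => x; rewrite invg1 mulg1 mul1g. Qed.

Lemma Inn_memF a b : Inn_mem a -> Inn_mem b -> Inn_mem (a / b).
Proof.
move=> [k ak] [l bl]; exists (k / l) => x; rewrite autM ak invgM invgK !mulgA.
suff -> : (b^-1) x = l^-1 * x * l by rewrite !mulgA.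
rewrite autV; apply: (canLR (gisoK b)).
by rewrite bl !mulgA mulgV mul1g mulgK.
Qed.

Lemma Inn_memJ a b : Inn_mem a -> Inn_mem (b * a * b^-1).
Proof.
move=> [k ak]; exists (b k) => x.
by rewrite !autM ak !gisoM gisoV autV gisoVK.
Qed.

Definition Inn : nsubgroup (autg K) :=
  @NSubgroup _ (Subgroup Inn_mem1 Inn_memF) Inn_memJ.

Definition Out : groupType := quot_group Inn.

Lemma aut_center_mem (a : autg K) (z : center) : center_mem (a (\val z)).
Proof. by move=> k; rewrite -[k](gisoVK a) -!gisoM (sgP z). Qed.

Definition aut_center (a : autg K) (z : center) : center :=
  @mksg _ center _ (aut_center_mem a z).

Lemma aut_center_cls a b :
  cls Inn a = cls Inn b -> aut_center a = aut_center b.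
Proof.
move=> /cls_eq [k abk]; apply/funext => z; apply: sg_inj => /=.
have := abk (\val z); rewrite -(sgP z) mulgK autM autV => /(congr1 a).
by rewrite gisoVK.
Qed.

Section CenterModule.
Variables (Q : groupType) (theta : {hom Q -> Out}).

(* Inner automorphisms fix the center pointwise, so that any representative of
   [theta q] may be used, see [ZK_actE]. *)
Definition ZK_act (q : Q) (z : center) : center := aut_center (rep (theta q)) z.

Lemma ZK_actE q a z : theta q = cls Inn a -> ZK_act q z = aut_center a z.
Proof. by rewrite -[theta q]repK => /aut_center_cls; rewrite /ZK_act => ->. Qed.

Lemma ZK_actM q : {morph ZK_act q : y z / y * z}.
Proof. by move=> y z; apply: sg_inj; rewrite /= gisoM. Qed.

Lemma ZK_act1 z : ZK_act 1 z = z.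
Proof. by rewrite (@ZK_actE _ 1) ?gmulf1 //; apply: sg_inj. Qed.

Lemma ZK_actA q1 q2 z : ZK_act (q1 * q2) z = ZK_act q1 (ZK_act q2 z).
Proof.
rewrite (@ZK_actE _ (rep (theta q1) * rep (theta q2))) ?clsM ?repK ?gmulfM //.
exact: sg_inj.
Qed.

Definition ZK_mod : gmodule Q :=
  @GModule Q center center_mulC ZK_act ZK_actM ZK_act1 ZK_actA.

End CenterModule.

Section OuterAction.
Variables (Q : groupType) (E : extension K Q).

Definition conj_fun (g : E) (k : K) : K := ext_ret (g * ext_in E k * g^-1).

Lemma conj_funE g k : ext_in E (conj_fun g k) = g * ext_in E k * g^-1.
Proof. by apply: ext_retE; rewrite !gmulfM ext_pr_in mulg1 gmulfV mulgV. Qed.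

Lemma conj_funM g : {morph conj_fun g : x y / x * y}.
Proof.
by move=> x y; apply: (@ext_inI _ _ E); rewrite gmulfM !conj_funE gmulfM !mulgA mulgVK.
Qed.

Lemma conj_funK g : cancel (conj_fun g) (conj_fun g^-1).
Proof.
move=> x; apply: (@ext_inI _ _ E).
by rewrite !conj_funE invgK !mulgA mulVg mul1g mulgVK.
Qed.

Lemma conj_funVK g : cancel (conj_fun g^-1) (conj_fun g).
Proof. by move=> x; rewrite -{1}[g]invgK conj_funK. Qed.

Definition conj_aut (g : E) : autg K :=
  GIso (conj_funM g) (conj_funK g) (conj_funVK g).

(* Does not depend on the lift, see [outer_actionE]. *)
Definition outer_action (q : Q) : Out := cls Inn (conj_aut (ext_lift E q)).

Lemma outer_actionE g : outer_action (ext_pr E g) = cls Inn (conj_aut g).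
Proof.
rewrite /outer_action; set h := ext_lift E _; pose k := ext_ret (h^-1 * g).
apply/cls_eq; exists k => x; rewrite autM autV.
apply: (@ext_inI _ _ E); rewrite -[LHS]/(ext_in E (conj_fun _ (conj_fun _ _))).
have kE : ext_in E k = h^-1 * g.
  by apply: ext_retE; rewrite gmulfM gmulfV ext_liftK mulVg.
have kVE : ext_in E k^-1 = (h^-1 * g)^-1 by rewrite gmulfV -kE.
rewrite !conj_funE !gmulfM kE kVE.
by rewrite !invgM !invgK !mulgA.
Qed.

End OuterAction.

End Outer.

Record ext_iso (K Q : groupType) (E1 E2 : extension K Q) := ExtIso {
  ei_iso :> giso E1 E2;
  ei_in : forall k, ei_iso (ext_in E1 k) = ext_in E2 k;
  ei_pr : forall g, ext_pr E2 (ei_iso g) = ext_pr E1 g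
}.

Section ModKOuter.
Variables (K P : groupType) (F : extension K P).
Notation i0 := (ext_in F).

Definition AutK_mem (a : autg F) : Prop := (a @` range i0 = range i0)%classic.

Lemma AutK_memP a : AutK_mem a <->
  (forall k, exists k', a (i0 k) = i0 k') /\ (forall k, exists k', a (i0 k') = i0 k).
Proof.
split=> [aK|[aK1 aK2]]; first split=> k.
- have : (range i0 (a (i0 k)))%classic by rewrite -aK; exists (i0 k) => //; exists k.
  by case=> k' _ <-; exists k'.
- have : (range i0 (i0 k))%classic by exists k.
  by rewrite -aK => -[_ [k' _ <-]] <-; exists k'.
apply/seteqP; split=> [_ [_ [k _ <-] <-]|_ [k _ <-]].
  by have [k' ->] := aK1 k; exists k'.
by have [k' <-] := aK2 k; exists (i0 k') => //; exists k'.
Qed.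

Lemma AutK_mem1 : AutK_mem 1.
Proof. by apply/AutK_memP; split=> k; exists k. Qed.

Lemma AutK_memF a b : AutK_mem a -> AutK_mem b -> AutK_mem (a / b).
Proof.
move=> /AutK_memP [a1 a2] /AutK_memP [b1 b2]; apply/AutK_memP; split=> k.
  have [k1 <-] := b2 k; have [k2 ak1] := a1 k1; exists k2.
  by rewrite autM autV gisoK.
have [k1 <-] := a2 k; have [k2 bk2] := b1 k1; exists k2.
by rewrite autM autV -bk2 gisoK.
Qed.

Definition AutK : subgroup (autg F) := Subgroup AutK_mem1 AutK_memF.

(* Out(N;K) is [OutK F] for an extension [F] with group [N]. *)
Definition InnK_mem (a : AutK) : Prop :=
  exists k : K, forall n : F, (\val a : autg F) n = i0 k * n * (i0 k)^-1.

Lemma InnK_mem1 : InnK_mem 1.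
Proof. by exists 1 => n; rewrite gmulf1 invg1 mulg1 mul1g. Qed.

Lemma InnK_memF a b : InnK_mem a -> InnK_mem b -> InnK_mem (a / b).
Proof.
move=> [k ak] [l bl]; exists (k / l) => n.
rewrite -[LHS]/((\val a : autg F) (giso_inv (\val b : autg F) n)).
rewrite ak gmulfM gmulfV invgM invgK !mulgA.
suff -> : giso_inv (\val b : autg F) n = (i0 l)^-1 * n * i0 l by rewrite !mulgA.
by apply: (canLR (gisoK _)); rewrite bl !mulgA mulgV mul1g mulgK.
Qed.

Lemma InnK_memJ a b : InnK_mem a -> InnK_mem (b * a * b^-1).
Proof.
have /AutK_memP [b1 _] := sgP b.
move=> [k ak]; have [k' bk] := b1 k; exists k' => n.
rewrite -[LHS]/((\val b : autg F) ((\val a : autg F) (giso_inv (\val b : autg F) n))).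
by rewrite ak !gisoM gisoV gisoVK bk.
Qed.

Definition InnK : nsubgroup AutK :=
  @NSubgroup _ (Subgroup InnK_mem1 InnK_memF) InnK_memJ.

Definition OutK : groupType := quot_group InnK.

Definition AutKNP_mem (a : autg F) : Prop :=
  (forall k, a (i0 k) = i0 k) /\ (forall n, ext_pr F (a n) = ext_pr F n).

Definition OutKNP (x : OutK) : Prop :=
  exists2 a : AutK, AutKNP_mem (\val a) & cls InnK a = x.

Lemma AutKNP_AutK a : AutKNP_mem a -> AutK_mem a.
Proof. by move=> [aK _]; apply/AutK_memP; split=> k; exists k. Qed.

Lemma self_conjM (m : F) : {morph (fun n => m * n * m^-1) : x y / x * y}.
Proof. by move=> x y; rewrite !mulgA mulgVK. Qed.
Lemma self_conjK (m : F) : cancel (fun n => m * n * m^-1) (fun n => m^-1 * n * m).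
Proof. by move=> x; rewrite !mulgA mulVg mul1g mulgVK. Qed.
Lemma self_conjVK (m : F) : cancel (fun n => m^-1 * n * m) (fun n => m * n * m^-1).
Proof. by move=> x; rewrite !mulgA mulgV mul1g mulgK. Qed.

Definition self_conj_aut (m : F) : autg F :=
  GIso (self_conjM m) (self_conjK m) (self_conjVK m).

Lemma self_conj_mem m : AutK_mem (self_conj_aut m).
Proof.
apply/AutK_memP; split=> k; first by exists (conj_fun m k); rewrite conj_funE.
exists (conj_fun m^-1 k); rewrite conj_funE invgK /=.
by rewrite !mulgA mulgV mul1g mulgK.
Qed.

Definition self_conj (m : F) : AutK := @mksg _ AutK _ (self_conj_mem m).

(* Does not depend on the lift, see [Theta_PE]. *)
Definition Theta_P (p : P) : OutK := cls InnK (self_conj (ext_lift F p)).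

Lemma Theta_PE m : Theta_P (ext_pr F m) = cls InnK (self_conj m).
Proof.
rewrite /Theta_P; set h := ext_lift F _; pose k := ext_ret (h^-1 * m).
have kE : i0 k = h^-1 * m.
  by apply: ext_retE; rewrite gmulfM gmulfV ext_liftK mulVg.
apply/cls_eq; exists k => n; rewrite kE.
rewrite -[LHS]/(h^-1 * (m * n * m^-1) * h).
by rewrite invgM invgK !mulgA.
Qed.

End ModKOuter.

Section Transport.
Variables (K P : groupType) (F F' : extension K P) (phi : ext_iso F' F).

Definition transport_aut (a : autg F') : autg F :=
  giso_comp phi (giso_comp a (giso_sym phi)).

Lemma transport_mem (a : AutK F') : AutK_mem (transport_aut (\val a)).
Proof.
have /AutK_memP [a1 a2] := sgP a.
have phiV k : giso_inv phi (ext_in F k) = ext_in F' k.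
  by apply: (canLR (gisoK phi)); rewrite ei_in.
apply/AutK_memP; split=> k /=.
  by have [k' ak] := a1 k; exists k'; rewrite phiV ak ei_in.
by have [k' ak] := a2 k; exists k'; rewrite phiV ak ei_in.
Qed.

Definition transport_AutK (a : AutK F') : AutK F :=
  @mksg _ (AutK F) _ (transport_mem a).

(* phi \o x \o phi^-1, independently of the representative of [x], see
   [transportE]. *)
Definition transport (x : OutK F') : OutK F :=
  cls (InnK F) (transport_AutK (rep x)).

Lemma transportE a : transport (cls (InnK F') a) = cls (InnK F) (transport_AutK a).
Proof.
rewrite /transport; set b := rep _.
have [k ab] : InnK_mem (b^-1 * a) by apply/(cls_eq (InnK F')); rewrite repK.
apply/cls_eq; exists k => n.
rewrite -[LHS]/(phi (giso_inv (\val b : autg F') (giso_inv phi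
  (phi ((\val a : autg F') (giso_inv phi n)))))) gisoK.
have := ab (giso_inv phi n).
rewrite -[X in X = _]/(giso_inv (\val b : autg F') ((\val a : autg F') _)) => ->.
by rewrite !gisoM gisoV gisoVK ei_in.
Qed.

End Transport.

Section Prolongation.
Variables (K P R : groupType) (Q : extension P R) (theta : {hom Q -> Out K}).
Variable F : extension K P.

(* [prol_theta]: restricting to [K] induces [theta]; [prol_conj]: acting on the
   quotient [P] of [N] induces conjugation of [P] by [Q]. *)
Record prolongation (T : Q -> OutK F) : Prop := Prolongation {
  prol_morph : {morph T : q1 q2 / q1 * q2};
  prol_P : forall p, T (ext_in Q p) = Theta_P F p;
  prol_theta : forall (q : Q) (a : AutK F), cls (InnK F) a = T q ->
    exists2 b : autg K, cls (Inn K) b = theta q &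
      forall k, (\val a : autg F) (ext_in F k) = ext_in F (b k);
  prol_conj : forall (q : Q) (a : AutK F), cls (InnK F) a = T q ->
    forall n : F, ext_in Q (ext_pr F ((\val a : autg F) n)) =
                  q * ext_in Q (ext_pr F n) * q^-1
}.

Definition AutKNP_conj (T1 T2 : Q -> OutK F) : Prop :=
  exists2 eta, OutKNP eta & forall q, T2 q = eta^-1 * T1 q * eta.

(* The conjugacy class of [T] among prolongations. *)
Definition prol_class (T : Q -> OutK F) : set (Q -> OutK F) :=
  [set T' | prolongation T' /\ AutKNP_conj T T']%classic.

End Prolongation.

Section Subextension.
Variables (K P R : groupType) (Q : extension P R) (E : extension K Q).
Notation j := (ext_in Q).
Notation pi := (ext_pr E).

Definition subext_mem (g : E) : Prop := exists p, j p = pi g.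

Lemma subext_mem1 : subext_mem 1.
Proof. by exists 1; rewrite !gmulf1. Qed.

Lemma subext_memF g h : subext_mem g -> subext_mem h -> subext_mem (g / h).
Proof. by move=> [p pg] [p' ph]; exists (p / p'); rewrite !gmulfF pg ph. Qed.

Definition subext_group : subgroup E := Subgroup subext_mem1 subext_memF.
Notation N := subext_group.

Lemma subext_in_mem k : subext_mem (ext_in E k).
Proof. by exists 1; rewrite gmulf1 ext_pr_in. Qed.

Definition subext_in (k : K) : N := @mksg _ N _ (subext_in_mem k).
Definition subext_pr (n : N) : P := ext_ret (pi (\val n)).

Lemma subext_prE n : j (subext_pr n) = pi (\val n).
Proof. by have [p pn] := sgP n; rewrite /subext_pr -pn ext_retK. Qed.

Lemma subext_inF : {morph subext_in : x y / x / y}.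
Proof. by move=> x y; apply: sg_inj; rewrite /= gmulfF. Qed.

Lemma subext_prF : {morph subext_pr : x y / x / y}.
Proof.
by move=> x y; apply: (@ext_inI _ _ Q); rewrite gmulfF !subext_prE /= gmulfF.
Qed.

HB.instance Definition _ := isGroupMorphism.Build K N subext_in subext_inF.
HB.instance Definition _ := isGroupMorphism.Build N P subext_pr subext_prF.

Lemma subext_inI : injective subext_in.
Proof. by move=> x y /(congr1 val) /= /ext_inI. Qed.

Lemma subext_prS p : exists n, subext_pr n = p.
Proof.
have [g gp] := ext_prS E (j p).
have Ng : subext_mem g by exists p.
by exists (@mksg _ N _ Ng); apply: (@ext_inI _ _ Q); rewrite subext_prE.
Qed.

Lemma subext_ker n : subext_pr n = 1 <-> exists k, subext_in k = n.
Proof.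
split=> [n1|[k <-]]; last first.
  by apply: (@ext_inI _ _ Q); rewrite subext_prE gmulf1 /= ext_pr_in.
have /ext_ker [k kn] : pi (\val n) = 1 by rewrite -subext_prE n1 gmulf1.
by exists k; apply: sg_inj.
Qed.

Definition subext : extension K P :=
  @Extension K P N subext_in subext_pr subext_inI subext_prS subext_ker.

Lemma conjN_mem (g : E) (n : subext) : subext_mem (g * (\val n : E) * g^-1).
Proof.
exists (pconj (pi g)^-1 (subext_pr n)).
by rewrite pconjE invgK subext_prE !gmulfM gmulfV.
Qed.

Definition conjN_fun (g : E) (n : subext) : subext := @mksg _ N _ (conjN_mem g n).

Lemma conjN_funM g : {morph conjN_fun g : x y / x * y}.
Proof. by move=> x y; apply: sg_inj; rewrite /= !mulgA mulgVK. Qed.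

Lemma conjN_funK g : cancel (conjN_fun g) (conjN_fun g^-1).
Proof.
by move=> x; apply: sg_inj; rewrite /= invgK !mulgA mulVg mul1g mulgVK.
Qed.

Lemma conjN_funVK g : cancel (conjN_fun g^-1) (conjN_fun g).
Proof. by move=> x; rewrite -{1}[g]invgK conjN_funK. Qed.

Definition conjN_aut (g : E) : autg subext :=
  GIso (conjN_funM g) (conjN_funK g) (conjN_funVK g).

Lemma conjN_AutK g : AutK_mem (conjN_aut g).
Proof.
apply/AutK_memP; split=> k.
  by exists (conj_fun g k); apply: sg_inj; rewrite /= conj_funE.
exists (conj_fun g^-1 k); apply: sg_inj.
by rewrite /= conj_funE invgK !mulgA mulgV mul1g mulgK.
Qed.

Definition conjN (g : E) : AutK subext := @mksg _ (AutK subext) _ (conjN_AutK g).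

(* Does not depend on the lift, see [modK_actionE]. *)
Definition modK_action (q : Q) : OutK subext := cls (InnK subext) (conjN (ext_lift E q)).

Lemma modK_actionE g : modK_action (pi g) = cls (InnK subext) (conjN g).
Proof.
rewrite /modK_action; set h := ext_lift E _; pose k := ext_ret (h^-1 * g).
have kE : ext_in E k = h^-1 * g.
  by apply: ext_retE; rewrite gmulfM gmulfV ext_liftK mulVg.
apply/cls_eq; exists k => n; apply: sg_inj.
rewrite -[LHS]/(h^-1 * (g * (\val n : E) * g^-1) * h^-1^-1).
rewrite -[RHS]/(ext_in E k * (\val n : E) * (ext_in E k)^-1) kE.
by rewrite !invgM !invgK !mulgA.
Qed.

End Subextension.

Section CenterAction.
Variables (K Q : groupType) (theta : {hom Q -> Out K}).
Variables (E : extension K Q) (hE : outer_action E =1 theta).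
Notation A := (ZK_mod theta).
Notation i := (ext_in E).

Lemma ZK_modE (g : E) (z : A) :
  i (\val (ext_pr E g ⊳ z)) = g * i (\val z) * g^-1.
Proof.
rewrite -[_ ⊳ _]/(ZK_act theta (ext_pr E g) z) (@ZK_actE _ _ _ _ (conj_aut g)).
  exact: conj_funE.
by rewrite -hE outer_actionE.
Qed.

Lemma ZK_central (z : A) (k : K) : \val z * k = k * \val z.
Proof. exact: (sgP (z : center K)). Qed.

End CenterAction.

Section Diamond.
Variables (K P R : groupType) (Q : extension P R) (theta : {hom Q -> Out K}).
Variables (E : extension K Q) (hE : outer_action E =1 theta).
Notation A := (ZK_mod theta).
Notation N := (subext E).
Notation i := (ext_in E).

(* [n |-> l (pi0 n) * n] *)
Definition twist_fun (l : Z1 (gmodP A)) (n : N) : N :=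
  ext_in N (\val (\val l (ext_pr N n) : A)) * n.

Lemma twist_funM l : {morph twist_fun l : x y / x * y}.
Proof.
move=> x y; rewrite /twist_fun gmulfM (@Z1E _ (gmodP A) l); apply: sg_inj.
rewrite -[LHS]/(i (\val (_ : A) * \val ((ext_in Q (ext_pr N x)) ⊳ (_ : A))) * (\val x * \val y)).
rewrite gmulfM -[ext_in Q _]/(ext_in Q (subext_pr x)) subext_prE (ZK_modE hE).
by rewrite /= !mulgA mulgVK.
Qed.

Lemma twist_fun_pr l n : ext_pr N (twist_fun l n) = ext_pr N n.
Proof. by rewrite /twist_fun gmulfM ext_pr_in mul1g. Qed.

Lemma twist_funVK l : cancel (twist_fun l) (twist_fun l^-1).
Proof.
move=> n; rewrite {1}/twist_fun twist_fun_pr /twist_fun.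
by rewrite -[ext_in N (\val (\val l^-1 _ : A))]/(ext_in N (_^-1)) gmulfV mulKg.
Qed.

Lemma twist_funK l : cancel (twist_fun l^-1) (twist_fun l).
Proof. by move=> n; rewrite -{1}[l]invgK twist_funVK. Qed.

Definition twist_aut (l : Z1 (gmodP A)) : autg N :=
  GIso (twist_funM l) (twist_funVK l) (twist_funK l).

Lemma twist_KNP l : AutKNP_mem (twist_aut l).
Proof.
split=> [k|n]; last exact: twist_fun_pr.
by rewrite /= /twist_fun ext_pr_in Z1_1 -[\val 1]/1 gmulf1 mul1g.
Qed.

Definition twist (l : Z1 (gmodP A)) : AutK N := @mksg _ (AutK N) _ (AutKNP_AutK (twist_KNP l)).

(* The identification of H^1(P, Z(K)) with Out(KNP;K); it does not depend on
   the representative of [u], see [H1_outE]. *)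
Definition H1_out (u : H1 (gmodP A)) : OutK N := cls (InnK N) (twist (rep u)).

Lemma H1_outE l : H1_out (cls (B1 (gmodP A)) l) = cls (InnK N) (twist l).
Proof.
rewrite /H1_out; set m := rep _.
have /H1_eq [a lm] : cls (B1 (gmodP A)) m = cls _ l by rewrite repK.
apply/cls_eq; exists (\val (a : A))^-1 => n.
rewrite -[LHS]/(twist_fun m^-1 (twist_fun l n)) {1}/twist_fun twist_fun_pr /twist_fun lm.
apply: sg_inj; set p := ext_pr N n; pose b : A := \val m p.
transitivity ((i (\val b))^-1 * (i (\val b) * ((i (\val (a : A)))^-1 *
    i (\val (ext_in Q p ⊳ (a : A)))) * \val n)).
  by rewrite -!gmulfV -!gmulfM.
rewrite -[ext_in Q p]/(ext_in Q (subext_pr n)) subext_prE (ZK_modE hE).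
transitivity (i (\val (a : A))^-1 * \val n * (i (\val (a : A))^-1)^-1); last by [].
by rewrite gmulfV invgK !mulgA mulVg mul1g mulgVK.
Qed.

Definition diamond (G : Z1 (H1_mod A)) (T : Q -> OutK N) (q : Q) : OutK N :=
  H1_out (\val G (ext_pr Q q)) * T q.

End Diamond.

Section Box.
Variables (K Q : groupType) (theta : {hom Q -> Out K}).
Variables (e : Z2 (ZK_mod theta)) (E : extension K Q).
Hypothesis hE : outer_action E =1 theta.
Notation A := (ZK_mod theta).
Notation i := (ext_in E).
Notation pi := (ext_pr E).

Definition box_type of outer_action E =1 theta & Z2 A : Type := E.
Notation B := (box_type hE e).
HB.instance Definition _ := Choice.on B.

Definition zof (q1 q2 : Q) : E := i (\val (\val e q1 q2 : A)).

(* [zof] takes values in [Z(K)], seen inside [E]. *)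
Definition box_mul (g1 g2 : B) : B :=
  zof (pi g1) (pi g2) * (g1 : E) * (g2 : E).
Definition box_inv (g : B) : B := (zof (pi g)^-1 (pi g))^-1 * (g : E)^-1.
Definition box_one : B := (1 : E).

Lemma pi_zof q1 q2 : pi (zof q1 q2) = 1. Proof. exact: ext_pr_in. Qed.

Lemma zof1q q : zof 1 q = 1. Proof. by rewrite /zof Z2_1g -[\val 1]/1 gmulf1. Qed.
Lemma zofq1 q : zof q 1 = 1. Proof. by rewrite /zof Z2_g1 -[\val 1]/1 gmulf1. Qed.

Lemma zofE (g : E) q2 q3 : zof (pi g) q2 * zof (pi g * q2) q3 =
  g * zof q2 q3 * g^-1 * zof (pi g) (q2 * q3).
Proof.
rewrite /zof -(ZK_modE hE) -!gmulfM; congr (ext_in E _).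
exact: (congr1 val (Z2E e (pi g) q2 q3)).
Qed.

Lemma zofC q1 q2 g : pi g = 1 -> zof q1 q2 * g = g * zof q1 q2.
Proof.
by move=> /ext_ker [k <-]; rewrite /zof -!gmulfM; congr (ext_in E _); apply: ZK_central.
Qed.

Lemma box_mulA : associative box_mul.
Proof.
move=> g1 g2 g3; rewrite /box_mul !gmulfM !pi_zof !mul1g.
transitivity ((g1 : E) * zof (pi g2) (pi g3) * (g1 : E)^-1 *
  zof (pi g1) (pi g2 * pi g3) * (g1 : E) * (g2 : E) * (g3 : E)).
  rewrite -zofC; last by rewrite !gmulfM pi_zof mulg1 gmulfV mulgV.
  by rewrite !mulgA mulgVK.
by rewrite -zofE -(zofC _ _ (pi_zof _ _)) !mulgA.
Qed.

Lemma box_mul1 : left_id box_one box_mul.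
Proof. by move=> g; rewrite /box_mul gmulf1 zof1q !mul1g. Qed.
Lemma box_mulr1 : right_id box_one box_mul.
Proof. by move=> g; rewrite /box_mul gmulf1 zofq1 mulg1 mul1g. Qed.
Lemma pi_box_inv g : pi (box_inv g) = (pi g)^-1.
Proof. by rewrite /box_inv gmulfM !gmulfV pi_zof invg1 mul1g. Qed.
Lemma box_mulV : left_inverse box_one box_inv box_mul.
Proof. by move=> g; rewrite /box_mul pi_box_inv /box_inv mulVKg mulVg. Qed.
Lemma box_mulrV : right_inverse box_one box_inv box_mul.
Proof.
move=> g; rewrite /box_mul pi_box_inv /box_inv.
have := zofE g (pi g)^-1 (pi g).
rewrite mulgV mulVg zof1q zofq1 !mulg1 => ->.
by rewrite !mulgA mulgVK mulgK mulgV.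
Qed.

HB.instance Definition _ := isGroup.Build B
  box_mulA box_mul1 box_mulr1 box_mulV box_mulrV.

Definition box_in (k : K) : B := i k.
Definition box_pr (g : B) : Q := pi g.

Lemma box_inM : {morph box_in : x y / x * y}.
Proof.
move=> x y; rewrite -[RHS]/(zof (pi (i x)) (pi (i y)) * i x * i y).
by rewrite !ext_pr_in zof1q mul1g -gmulfM.
Qed.
Lemma box_prM : {morph box_pr : x y / x * y}.
Proof.
move=> x y; rewrite -[LHS]/(pi (zof (pi x) (pi y) * (x : E) * (y : E))).
by rewrite !gmulfM pi_zof mul1g.
Qed.

HB.instance Definition _ :=
  isUMagmaMorphism.Build K B box_in (@gmulf1 _ _ i : box_in 1 = 1, box_inM).
HB.instance Definition _ :=
  isUMagmaMorphism.Build B Q box_pr (@gmulf1 _ _ pi : box_pr 1 = 1, box_prM).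

Definition box : extension K Q :=
  @Extension K Q B box_in box_pr (@ext_inI _ _ E) (@ext_prS _ _ E) (@ext_ker _ _ E).

End Box.

Definition ext_isomorphic (K Q : groupType) (E1 E2 : extension K Q) : Prop :=
  inhabited (ext_iso E1 E2).

(* [x] is the class of the cocycles [e] such that [E'] is isomorphic to the
   extension [e ⊠ E]. *)
Definition is_ratio (K Q : groupType) (theta : {hom Q -> Out K})
    (E : extension K Q) (hE : outer_action E =1 theta) (E' : extension K Q)
    (x : H2 (ZK_mod theta)) : Prop :=
  exists2 e : Z2 (ZK_mod theta), x = cls (B2 (ZK_mod theta)) e &
    ext_isomorphic E' (box e hE).

(* The image of [c] under the map induced by [G |-> diamond hE G T]. *)
Definition diamond_class (K P R : groupType) (Q : extension P R)
    (theta : {hom Q -> Out K}) (E : extension K Q)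
    (hE : outer_action E =1 theta) (T : Q -> OutK (subext E))
    (c : H1 (H1_mod (ZK_mod theta))) : set (Q -> OutK (subext E)) :=
  [set T' | exists2 G, cls (B1 (H1_mod (ZK_mod theta))) G = c &
                       prol_class theta (diamond hE G T) T']%classic.

(* Main.v *)
Require Import Defs.
From mathcomp Require Import all_boot.
From mathcomp Require Import boolp classical_sets.

(** Write G and G' for the two extensions, N and N' for their P-subextensions,
    and take an isomorphism t from G' to the twisted extension e ⊠ G.  Seen as
    a map to the set underlying G, t is multiplicative up to e, and it is the
    identity on K.  On N' it therefore differs from [phi] by a factor that
    is central in K and depends only on the image in P.  Extending this factor
    to a normalized cochain on Q and dividing t by it changes e by a coboundary
    ([bs_adjust]), so that one may assume that t restricts to [phi] on N'.
    Since [phi] is a homomorphism, the new cocycle e is trivial on P, and so its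
    class lies in the kernel of the restriction and [rd] is computed from e.

    Now let g be in G', over q in Q, and n in N'.  Applying t to both sides of
    g n = (g n g^-1) g compares conjugation by g on N', carried over to N by
    [phi], with conjugation by t(g) on N: they differ by the quotient
      e(q, q^-1 p q) e(p, q)^-1,
    where p in P is the image of g n g^-1.  This is the formula
    that defines the cocycle Γ_e, whence ^φΘ' = Γ_e ⋄ Θ on the nose
    ([transport_modK]).

    The comparison of classes follows from this identity.  The map - ⋄ Θ is injective
    because an automorphism n |-> λ(π_0(n)) n that is conjugation by an element
    of K is so by a central one, which makes λ a coboundary ([H1_outI],
    [diamondI]); this gives Γ = Γ_e.  Cohomologous cocycles give
    conjugate prolongations because Θ(q) acts on Out(KNP;K) by conjugation as
    q acts on H^1(P, Z(K)) ([modK_H1_out], [diamond_conj]).  Two choices of φ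
    differ by an automorphism in Aut(KNP) ([transport_conj]).  Finally, ^φΘ' is
    a prolongation because Θ' is one and isomorphisms of extensions of K by P
    respect the conditions ([modK_prolongation], [transport_prolongation]). *)

Set Implicit Arguments.
Unset Strict Implicit.

Local Open Scope group_scope.

(** * Transport of mod-K outer actions along an isomorphism *)

Section Transport.
Variables (K P : groupType).

Lemma ei_sym_in (F F' : extension K P) (phi : ext_iso F' F) k :
  giso_sym phi (ext_in F k) = ext_in F' k.
Proof. by apply: (canLR (gisoK phi)); rewrite ei_in. Qed.

Lemma ei_sym_pr (F F' : extension K P) (phi : ext_iso F' F) n :
  ext_pr F' (giso_sym phi n) = ext_pr F n.
Proof. by rewrite -{2}[n](gisoVK phi) ei_pr. Qed.

Definition ei_sym (F F' : extension K P) (phi : ext_iso F' F) : ext_iso F F' :=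
  @ExtIso K P F F' (giso_sym phi) (@ei_sym_in F F' phi) (@ei_sym_pr F F' phi).

Variables (F F' : extension K P) (phi : ext_iso F' F).

Lemma AutK_eq (a b : AutK F) :
  (forall n, (\val a : autg F) n = (\val b : autg F) n) -> a = b.
Proof. by move=> ab; apply/sg_inj/giso_eq. Qed.

Lemma transportM : {morph transport phi : x y / x * y}.
Proof.
elim/quot_ind => a; elim/quot_ind => b; rewrite -clsM !transportE -clsM.
by congr cls; apply: AutK_eq => n /=; rewrite gisoK.
Qed.

Lemma transport_sym x : transport (ei_sym phi) (transport phi x) = x.
Proof.
elim/quot_ind: x => a; rewrite !transportE; congr cls.
apply/sg_inj/giso_eq => n /=.
by rewrite !gisoK.
Qed.

Lemma transport_Theta_P p : transport phi (Theta_P F' p) = Theta_P F p.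
Proof.
rewrite -[in RHS](ext_liftK F' p) -(ei_pr phi) Theta_PE transportE; congr cls.
by apply: AutK_eq => n; rewrite /= !gisoM gisoV gisoVK.
Qed.

Lemma transport_prolongation (R : groupType) (Q : extension P R)
    (theta : {hom Q -> Out K}) (T : Q -> OutK F') :
  prolongation theta T -> prolongation theta (fun q => transport phi (T q)).
Proof.
have symE q (a : AutK F) : cls (InnK F) a = transport phi (T q) ->
    cls (InnK F') (transport_AutK (ei_sym phi) a) = T q.
  by move=> aq; rewrite -transportE aq transport_sym.
move=> [TM TP Ttheta Tconj]; split=> [q1 q2|p|q a /symE aq|q a /symE aq n].
- by rewrite TM transportM.
- by rewrite TP transport_Theta_P.
- have [b bq ab] := Ttheta q _ aq; exists b => // k.
  by rewrite -(ei_in phi (b k)) -ab /= gisoVK ei_in.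
rewrite -[n](gisoVK phi) ei_pr -(Tconj q _ aq) /=.
by rewrite ei_sym_pr.
Qed.

(** The conjugating element is the class of [phi \o psi^-1]. *)
Lemma transport_conj (psi : ext_iso F' F) (U : Type) (T : U -> OutK F') :
  exists2 eta, OutKNP eta &
  forall u, transport psi (T u) = eta^-1 * transport phi (T u) * eta.
Proof.
pose f : autg F := giso_comp phi (giso_sym psi).
have fKNP : AutKNP_mem f.
  split=> [k|n]; first by rewrite -[LHS]/(phi (giso_sym psi _)) ei_sym_in ei_in.
  by rewrite -[f n]/(phi (giso_sym psi n)) ei_pr ei_sym_pr.
pose a : AutK F := @mksg _ (AutK F) _ (AutKNP_AutK fKNP).
exists (cls _ a); first by exists a.
move=> u; elim/quot_ind: (T u) => b; rewrite !transportE -clsV.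
rewrite -(@clsM _ (InnK F) a^-1 (transport_AutK phi b)) -clsM; congr cls.
apply: AutK_eq => n; pose b' := (\val b : autg F').
rewrite -[RHS]/(psi (giso_inv phi (phi (b' (giso_inv phi (phi (giso_inv psi n))))))).
by rewrite !gisoK.
Qed.

End Transport.

(** * The mod-K outer action and its twists by 1-cocycles *)

Section ModK.
Variables (K P R : groupType) (Q : extension P R) (theta : {hom Q -> Out K}).
Variables (E : extension K Q) (hE : outer_action E =1 theta).
Notation A := (ZK_mod theta).
Notation N := (subext E).
Notation T := (modK_action E).

Lemma modK_actionM : {morph T : q1 q2 / q1 * q2}.
Proof.
move=> q1 q2; rewrite -(ext_liftK E q1) -(ext_liftK E q2) -gmulfM !modK_actionE.
rewrite -clsM; congr cls; apply: AutK_eq => n; apply: sg_inj.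
by rewrite /= invgM !mulgA.
Qed.

(** An inner automorphism by an element of K can be absorbed in the lift, so
    every representative of the class is itself a conjugation. *)
Lemma modK_action_rep (q : Q) (a : AutK N) : cls (InnK N) a = T q ->
  exists2 g, ext_pr E g = q & a = conjN g.
Proof.
rewrite -{1}(ext_liftK E q) modK_actionE => /esym/cls_eq [k ak].
exists (ext_lift E q * ext_in E k).
  by rewrite gmulfM ext_pr_in mulg1 ext_liftK.
apply: AutK_eq => n.
transitivity (conjN_fun (ext_lift E q) (((\val (conjN (ext_lift E q))^-1 * \val a : autg N)) n)).
  by rewrite /= conjN_funVK.
rewrite [X in conjN_fun _ X]ak; apply: sg_inj.
by rewrite /= !invgM !mulgA.
Qed.

Lemma modK_action_in p : T (ext_in Q p) = Theta_P N p.
Proof.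
have [n <-] := ext_prS N p.
rewrite Theta_PE -[ext_pr N n]/(subext_pr n) subext_prE modK_actionE.
by congr cls; apply: AutK_eq => m; apply: sg_inj.
Qed.

Lemma modK_prolongation : prolongation theta T.
Proof.
split=> [||q a|q a]; [exact: modK_actionM|exact: modK_action_in| |].
- move=> /modK_action_rep [g <- ->]; exists (conj_aut g).
    by rewrite -hE outer_actionE.
  by move=> k; apply: sg_inj; rewrite /= conj_funE.
move=> /modK_action_rep [g <- ->] n.
by rewrite /= !subext_prE /= !gmulfM gmulfV.
Qed.

Lemma twistM (l m : Z1 (gmodP A)) : twist hE (l * m) = twist hE l * twist hE m.
Proof.
apply: AutK_eq => n; apply: sg_inj.
rewrite -[RHS]/(sg_val (twist_fun l (twist_fun m n))) {1}/twist_fun twist_fun_pr.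
by rewrite /twist_fun mulgA -gmulfM.
Qed.

Lemma H1_outM : {morph H1_out hE : u v / u * v}.
Proof.
by elim/quot_ind => l; elim/quot_ind => m; rewrite -clsM !H1_outE twistM clsM.
Qed.

Lemma H1_outV u : H1_out hE u^-1 = (H1_out hE u)^-1.
Proof.
have H1 : H1_out hE 1 = 1.
  by apply: (mulgI (H1_out hE 1)); rewrite -H1_outM !mulg1.
by apply/esym/mulg1_eq; rewrite -H1_outM mulgV.
Qed.

(** Suppose that twisting by l and by m differ by conjugation by k in K.  Both
    twists fix K pointwise, which forces k to be central; conjugation by k then
    multiplies n by k / (p . k), with p the image of n, and l and m differ by
    the coboundary of k^-1. *)
Lemma H1_outI : injective (H1_out hE).
Proof.
elim/quot_ind => l; elim/quot_ind => m; rewrite !H1_outE => /cls_eq [k lmk].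
have {}lmk n : twist_fun m n = twist_fun l (ext_in N k * n * (ext_in N k)^-1).
  by rewrite -lmk; apply: (canRL (gisoVK (twist_aut hE l))).
have kZ : center K k.
  move=> x; have := lmk (ext_in N x).
  rewrite /twist_fun !gmulfM !gmulfV !ext_pr_in mulg1 mulgV !Z1_1 !gmulf1 !mul1g.
  by rewrite -gmulfV -!gmulfM => /subext_inI {2}->; rewrite mulgVK.
pose a : A := @mksg _ (center K) _ kZ.
apply/H1_eq; exists a^-1 => p; have [n <-] := ext_prS N p.
apply/sg_inj/(@subext_inI _ _ _ _ E)/(mulIg n); rewrite -[LHS]/(twist_fun m n) lmk.
rewrite /twist_fun !gmulfM ext_pr_in gmulfV ext_pr_in mul1g invg1 mulg1.
apply: sg_inj.
rewrite -[RHS]/(ext_in E (\val (\val l (ext_pr N n) : A)) * (ext_in E (\val (a^-1^-1)) * ext_in E (\val (ext_in Q (subext_pr n) ⊳ a^-1))) * \val n).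
rewrite subext_prE (ZK_modE hE) /= invgK gmulfV.
by rewrite !mulgA mulgVK.
Qed.

(** The action of R on H^1(P, Z(K)) becomes, inside Out(N;K), conjugation by
    the mod-K outer action. *)
Lemma modK_H1_out (q : Q) (u : H1 (gmodP A)) :
  T q * H1_out hE u = H1_out hE (H1_act (ext_pr Q q) u) * T q.
Proof.
elim/quot_ind: u => l; rewrite H1_actE -(ext_liftK E q); move: (ext_lift E q) => g.
rewrite !H1_outE modK_actionE -!clsM; congr cls; apply: AutK_eq => n.
rewrite -[LHS]/(conjN_fun g (twist_fun l n)) -[RHS]/(twist_fun _ (conjN_fun g n)).
apply: sg_inj; rewrite /twist_fun.
rewrite -[RHS]/(ext_in E (\val (ext_pr E g ⊳ (\val l (pconj (ext_pr E g) (subext_pr (conjN_fun g n))) : A))) * (g * \val n * g^-1)).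
rewrite (ZK_modE hE).
have -> : pconj (ext_pr E g) (subext_pr (conjN_fun g n)) = ext_pr N n.
  apply: (@ext_inI _ _ Q); rewrite pconjE !subext_prE /= !gmulfM gmulfV.
  by rewrite !mulgA mulVg mul1g mulgVK.
by rewrite /= !mulgA !mulgVK.
Qed.

Lemma diamondI (G1 G2 : Z1 (H1_mod A)) :
  diamond hE G1 T =1 diamond hE G2 T -> G1 = G2.
Proof.
move=> G12; apply/sg_inj/funext => r; rewrite -(ext_liftK Q r).
exact/H1_outI/(mulIg _)/G12.
Qed.

(** If the cocycles differ by the coboundary of u, conjugation by u works. *)
Lemma diamond_conj (G1 G2 : Z1 (H1_mod A)) :
  cls (B1 (H1_mod A)) G1 = cls (B1 (H1_mod A)) G2 ->
  AutKNP_conj (diamond hE G1 T) (diamond hE G2 T).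
Proof.
move=> /H1_eq [u G12]; exists (H1_out hE u).
  by exists (twist hE (rep u)) => //; apply: twist_KNP.
have conjE (X : groupType) (x y y' t : X) : t * y = y' * t ->
    y^-1 * x = x * y^-1 -> x * (y^-1 * y') * t = y^-1 * (x * t) * y.
  by move=> ty xy; rewrite -!mulgA ty !mulgA xy.
move=> q; rewrite /diamond G12 -[(_ ⊳ u)%g]/(H1_act _ u) !H1_outM H1_outV.
apply: conjE; first exact: modK_H1_out.
by rewrite -H1_outV -!H1_outM (@gm_mulC _ (H1_mod A)).
Qed.

Lemma AutKNP_conj_trans (F : extension K P) (T1 T2 T3 : Q -> OutK F) :
  AutKNP_conj T1 T2 -> AutKNP_conj T2 T3 -> AutKNP_conj T1 T3.
Proof.
move=> [_ [a aKNP <-] T12] [_ [b bKNP <-] T23].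
exists (cls (InnK F) a * cls (InnK F) b) => [|q]; last by rewrite T23 T12 invgM !mulgA.
exists (a * b); last by rewrite clsM.
have [[ak ap] [bk bp]] := (aKNP, bKNP).
by split=> [k|n]; rewrite [\val _]/= autM ?bk ?ak ?ap ?bp.
Qed.

End ModK.

(** * Extensions with the same outer action *)

Lemma Z2_valM (H : groupType) (M : gmodule H) (d e : Z2 M) h1 h2 :
  \val (d * e) h1 h2 = \val d h1 h2 * \val e h1 h2.
Proof. by []. Qed.

Lemma P_trivial_H2_P (P R : groupType) (Q : extension P R) (M : gmodule Q)
    (e : Z2 M) : P_trivial e -> H2_P_mem (cls (B2 M) e).
Proof.
move=> eP; rewrite /H2_P_mem res_H2E -(cls1 (B2 (gmodP M))); congr cls.
by apply/sg_inj/funext => p1; apply/funext => p2; apply: eP.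
Qed.

Section Ratio.
Variables (K P R : groupType) (Q : extension P R) (theta : {hom Q -> Out K}).
Variables (E E' : extension K Q) (hE : outer_action E =1 theta).
Variable phi : ext_iso (subext E') (subext E).
Notation A := (ZK_mod theta).
Notation N := (subext E).
Notation N' := (subext E').
Notation i := (ext_in E).
Notation i' := (ext_in E').
Notation pi := (ext_pr E).
Notation pi' := (ext_pr E').

(** These are the homomorphisms over Q from E' to the extension e ⊠ E.  As the
    latter has the same elements as E, they are kept as maps to E, so that only
    the multiplication of E appears in computations. *)
Record box_hom (e : Z2 A) (s : E' -> E) : Prop := BoxHom {
  bs_pr : forall g, pi (s g) = pi' g;
  bsM : forall g1 g2, s (g1 * g2) = zof e E (pi' g1) (pi' g2) * s g1 * s g2
}.

(** [phi] with values in E, where it can be compared with a map from E'. *)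
Definition phiv (n : N') : E := \val (phi n).

Lemma phivM : {morph phiv : m n / m * n}.
Proof. by move=> m n; rewrite /phiv gisoM. Qed.

Lemma phiv_in k : phiv (ext_in N' k) = i k.
Proof. by rewrite /phiv ei_in. Qed.

Lemma phiv_pr n : pi (phiv n) = pi' (\val n).
Proof. by rewrite -!subext_prE -[subext_pr (phi n)]/(ext_pr N (phi n)) ei_pr. Qed.

Lemma iso_box_hom (e : Z2 A) (t : ext_iso E' (box e hE)) :
  box_hom e (t : E' -> E) /\ (forall k, (t : E' -> E) (i' k) = i k).
Proof.
have tpr g : pi ((t : E' -> E) g) = pi' g by apply: (ei_pr t).
split; last by move=> k; apply: (ei_in t).
split=> // g1 g2; rewrite gisoM -!tpr; exact: erefl.
Qed.

Section Defect.
Variables (e : Z2 A) (t : E' -> E) (te : box_hom e t).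
Hypothesis tin : forall k, t (i' k) = i k.

Lemma bs_inl k g : t (i' k * g) = i k * t g.
Proof. by rewrite (bsM te) ext_pr_in zof1q mul1g tin. Qed.

Lemma bs_inr k g : t (g * i' k) = t g * i k.
Proof. by rewrite (bsM te) ext_pr_in zofq1 mul1g tin. Qed.

(* The failure of [t] to extend [phi]. *)
Let d (n : N') : E := t (\val n) * (phiv n)^-1.

Let d_inr k n : d (n * ext_in N' k) = d n.
Proof.
rewrite /d phivM phiv_in -[\val (_ * _)]/(\val n * i' k) bs_inr.
by rewrite invgM mulgA mulgK.
Qed.

Let d_inl k n : d (ext_in N' k * n) = i k * d n * (i k)^-1.
Proof.
rewrite /d phivM phiv_in -[\val (ext_in N' k * _)]/(i' k * \val n) bs_inl.
by rewrite invgM !mulgA.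
Qed.

Let d_pr m n : ext_pr N' m = ext_pr N' n -> d m = d n.
Proof.
move=> mn; have nm1 : ext_pr N' (n^-1 * m) = 1 by rewrite gmulfM gmulfV mn mulVg.
by rewrite -[m](mulKg n^-1) invgK -(ext_retE nm1) d_inr.
Qed.

(** The defect d(n) = t(n) / phi(n) satisfies d(n k) = d(n) and
    d(k n) = k d(n) k^-1 for k in K: by the former it depends only on the image
    of n in P, and as k n and n have the same image, the latter then says that
    it is central.  The case of q outside P, in which no n lies over q, lets
    the factors be chosen for all q at once, as a cochain on Q. *)
Lemma defect_central (q : Q) :
  exists a : A, forall n : N', pi' (\val n) = q -> t (\val n) = i (\val a) * phiv n.
Proof.
have [[p <-]|qP] := pselect (exists p, ext_in Q p = q); last first.
  by exists 1 => n nq; case: qP; exists (subext_pr n); rewrite subext_prE.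
have [m mp] := ext_prS N' p.
have /ext_ker [z zE] : pi (d m) = 1.
  by rewrite /d gmulfM gmulfV (bs_pr te) phiv_pr mulgV.
have zZ : center K z.
  move=> k; apply: (@ext_inI _ _ E); rewrite !gmulfM zE.
  have : d m = i k * d m * (i k)^-1.
    by rewrite -d_inl; apply: d_pr; rewrite gmulfM ext_pr_in mul1g.
  by move=> {1}->; rewrite mulgVK.
exists (@mksg _ (center K) _ zZ) => n np.
rewrite [\val _]/= zE (@d_pr m n) ?mulgVK //.
by apply: (@ext_inI _ _ Q); rewrite mp -np /= subext_prE.
Qed.

(** Dividing [t] by the defect, extended to Q, makes it extend [phi], at the cost
    of multiplying e by the coboundary of the defect. *)
Lemma bs_adjust : exists e0 s,
  [/\ cls (B2 A) e0 = cls (B2 A) e, box_hom e0 s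
    & forall n, s (\val n) = phiv n].
Proof.
have [w wE] := choice defect_central.
have w1 : w 1 = 1.
  apply/sg_inj/(@ext_inI _ _ E).
  have := wE 1 1; rewrite -[phiv 1]/(\val (phi 1)) giso1 !sgv1 !gmulf1 mulg1 => <- //.
  by have := tin 1; rewrite !gmulf1.
pose dw : Z2 A := @mksg _ (Z2 A) _ (cobd_Z2 w1).
pose s g : E := (i (\val (w (pi' g))))^-1 * t g.
exists (e * dw), s; split.
- apply/esym/cls_eq; exists w => // h1 h2.
  by rewrite mulKg.
- split=> [g|g1 g2].
    by rewrite /s gmulfM gmulfV ext_pr_in invg1 mul1g (bs_pr te).
  rewrite /s (bsM te) gmulfM -!(bs_pr te).
  set q1 := pi (t g1); set q2 := pi (t g2).
  have edwE : \val (e * dw) q1 q2 =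
      (w (q1 * q2))^-1 * \val e q1 q2 * (q1 ⊳ w q2) * w q1.
    rewrite Z2_valM [\val dw q1 q2]/= /cobd.
    by abel (@gm_mulC _ A).
  have -> : zof (e * dw) E q1 q2 =
      (i (\val (w (q1 * q2))))^-1 * zof e E q1 q2 *
      (t g1 * i (\val (w q2)) * (t g1)^-1) * i (\val (w q1)).
    by rewrite -(ZK_modE hE) /zof edwE -gmulfV -!gmulfM.
  by rewrite !mulgA mulgK mulgVK mulgK.
by move=> n; rewrite /s (wE _ n erefl) mulKg.
Qed.

End Defect.

Section Reduction.
Variables (e : Z2 A) (s : E' -> E) (se : box_hom e s).
Hypothesis sphi : forall n, s (\val n) = phiv n.

(** On N' the map [s] is multiplicative, as [phi] is, but also multiplicative
    only up to the values of e, which must therefore be trivial. *)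
Lemma bs_P_trivial : P_trivial e.
Proof.
move=> p1 p2; have [n1 <-] := ext_prS N' p1; have [n2 <-] := ext_prS N' p2.
have := bsM se (\val n1) (\val n2).
rewrite -sgvM !sphi phivM -mulgA -[LHS]mul1g => /mulIg.
rewrite -!subext_prE /zof -(@gmulf1 _ _ i) => /ext_inI /esym H.
exact: sg_inj.
Qed.

(** The image under [s] of g n = (g n g^-1) g, compared on both sides. *)
Lemma transport_modK (q : Q) :
  transport phi (modK_action E' q) =
    diamond hE (Gamma_of bs_P_trivial) (modK_action E) q.
Proof.
rewrite -(ext_liftK E' q); move: (ext_lift E' q) => g.
rewrite /diamond modK_actionE transportE Gamma_ofE H1_outE.
rewrite -(bs_pr se) modK_actionE -clsM; congr cls; apply: AutK_eq => n.
set q1 := pi (s g).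
pose n' := giso_inv phi n; pose m' := conjN_fun g n'.
rewrite -[LHS]/(phi m').
rewrite -[RHS]/(twist_fun (Gamma1 bs_P_trivial q1) (conjN_fun (s g) n)).
set m := conjN_fun (s g) n; set p := ext_pr N m.
apply: sg_inj; rewrite -[LHS]/(phiv m').
transitivity (i (\val (Gamma_fun e q1 p)) * (s g * \val n * (s g)^-1)); last by [].
have mp : pi' (\val m') = ext_in Q p.
  by rewrite /p /= subext_prE /= /m' /= !gmulfM !gmulfV /q1 !(bs_pr se) -phiv_pr /n' /phiv gisoVK.
have np : pi' (\val n') = ext_in Q (pconj q1 p).
  rewrite pconjE -mp /m' /= !gmulfM gmulfV /q1 (bs_pr se).
  by rewrite !mulgA mulVg mul1g mulgVK.
have nE : phiv n' = \val n by rewrite /phiv /n' gisoVK.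
have gn : g * \val n' = \val m' * g by rewrite /m' /= mulgVK.
have := congr1 s gn; rewrite (bsM se g) (bsM se (\val m')) mp np -(bs_pr se) -/q1 !sphi nE => szn.
have -> : i (\val (Gamma_fun e q1 p)) =
    (zof e E (ext_in Q p) q1)^-1 * zof e E q1 (ext_in Q (pconj q1 p)).
  by rewrite /zof -gmulfV -gmulfM /Gamma_fun (@gm_mulC _ A).
apply: (mulIg (s g)); apply: (mulgI (zof e E (ext_in Q p) q1)).
by rewrite [LHS]mulgA -szn !mulgA mulgV mul1g mulgVK.
Qed.

End Reduction.

Lemma ratio_Gamma x : is_ratio hE E' x ->
  exists e, exists eP : P_trivial e, cls (B2 A) e = x /\
    forall q, transport phi (modK_action E' q) = diamond hE (Gamma_of eP) (modK_action E) q.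
Proof.
move=> [e -> [t]]; have [te tin] := iso_box_hom t.
have [e0 [s [<- se sphi]]] := bs_adjust te tin.
by exists e0, (bs_P_trivial se sphi); split=> // q; apply: transport_modK.
Qed.

End Ratio.

Unset Implicit Arguments.

Theorem proposition16p3 (K P R : groupType) (Q : extension P R)
    (theta : {hom Q -> Out K}) (G G' : extension K Q)
    (hG : outer_action G =1 theta) (hG' : outer_action G' =1 theta)
    (phi : ext_iso (subext G') (subext G)) :
  let A : gmodule Q := ZK_mod theta in
  let Theta : Q -> OutK (subext G) := modK_action G in
  let Theta' : Q -> OutK (subext G') := modK_action G' in
  let conj_Theta' (f : ext_iso (subext G') (subext G)) : Q -> OutK (subext G) :=
    fun q => transport f (Theta' q) in
  [/\ forall (Gamma : Z1 (H1_mod A)) (x : H2 A),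
        conj_Theta' phi =1 diamond hG Gamma Theta -> is_ratio hG G' x ->
        exists2 y : H2_P A, sg_val y = x & rd y = cls (B1 (H1_mod A)) Gamma,
      prolongation theta (conj_Theta' phi),
      forall y : H2_P A, is_ratio hG G' (sg_val y) ->
        diamond_class hG Theta (rd y) = prol_class theta (conj_Theta' phi)
    & forall psi : ext_iso (subext G') (subext G),
        AutKNP_conj (conj_Theta' phi) (conj_Theta' psi)].
Proof.
move=> A Theta Theta' conj_Theta'.
split=> [Gamma x GammaE /(ratio_Gamma phi) [e [eP [<- eE]]]| |y|psi].
- have eH : H2_P_mem (cls (B2 A) e) by exact: P_trivial_H2_P.
  exists (@mksg _ (H2_P A) _ eH) => //; rewrite (rdE eP) //.
  have <- // : Gamma = Gamma_of eP.
  by apply: (diamondI (hE := hG)) => q; rewrite -eE -GammaE.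
- exact/transport_prolongation/modK_prolongation.
- move=> /(ratio_Gamma phi) [e [eP [ye eE]]].
  rewrite (rdE eP) //; have {}eE : conj_Theta' phi = diamond hG (Gamma_of eP) Theta.
    by apply/funext.
  rewrite eE; apply/seteqP; split=> [T [G0 G0e [Tp T0]]|T T0]; last by exists (Gamma_of eP).
  by split=> //; apply: AutKNP_conj_trans T0; apply: diamond_conj.
- exact: transport_conj.
Qed.
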